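(* Let $N\ge 3$, let $\Omega\subset\mathbb{R}^N$ be a bounded domain with $n$ different poles $a_1,\dots,a_n\in\Omega$, $n\ge 2$, and let $\gamma_1,\dots,\gamma_n>0$ be given. If the Hardy inequality $$\int_\Omega|\nabla u|^2\,dx\ \ge\ C^*(\Omega)\sum_{i=1}^n\int_\Omega\gamma_i\frac{|u|^2}{|x-a_i|^2}\,dx$$ holds for every $u\in H_0^1(\Omega)$ with sharp constant $C^*(\Omega)$, then $$C^*(\Omega)\sum_{i=1}^n\gamma_i>\frac{(N-2)^2}{4}\qquad\text{and}\qquad \max_{1\le i\le n}C^*(\Omega)\gamma_i\le\frac{(N-2)^2}{4}.$$
   Context: ''Sharp'' means that $C^*(\Omega)$ is the largest constant for which the displayed inequality holds for all $u\in H_0^1(\Omega)$. *)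

(* Defs.v *)
From HB Require Import structures.
From mathcomp Require Export all_boot all_order all_algebra.
From mathcomp Require Export all_classical all_reals all_analysis.
From mathcomp Require Export measurable_realfun.

Set Implicit Arguments.
Unset Strict Implicit.
Unset Printing Implicit Defensive.

Import Order.TTheory GRing.Theory Num.Theory.
Import numFieldNormedType.Exports.

Local Open Scope classical_set_scope.
Local Open Scope ring_scope.

Section rV_measurable.
Context {R : realType} {n : nat}.

Let coord (i : 'I_n) (x : 'rV[R]_n) : R := x ord0 i.

Let rV_set0 : g_sigma_preimage coord set0.
Proof. exact: sigma_algebra0. Qed.

Let rV_setC A : g_sigma_preimage coord A -> g_sigma_preimage coord (~` A).
Proof. exact: sigma_algebraC. Qed.

Let rV_bigcup (F : (set 'rV[R]_n)^nat) :
  (forall i, g_sigma_preimage coord (F i)) ->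
  g_sigma_preimage coord (\bigcup_i F i).
Proof. exact: sigma_algebra_bigcup. Qed.

HB.instance Definition _ := @isMeasurable.Build default_measure_display
  'rV[R]_n (g_sigma_preimage coord) rV_set0 rV_setC rV_bigcup.

End rV_measurable.

Lemma measurable_coord (R : realType) (n : nat) (i : 'I_n) :
  measurable_fun [set: 'rV[R]_n] (fun x => x ord0 i).
Proof.
move=> _ Y mY; rewrite setTI; apply: sub_sigma_algebra => /=.
rewrite -bigcup_seq/=; exists i => /=; first by rewrite mem_index_enum.
by exists Y => //; rewrite setTI.
Qed.

Lemma measurable_fun_rV d (T : measurableType d) (R : realType) (n : nat)
    (f : T -> 'rV[R]_n) :
  (forall i, measurable_fun [set: T] (fun t => f t ord0 i)) ->
  measurable_fun [set: T] f.
Proof.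
move=> mf _ A mA.
have : preimage_set_system [set: T] f
    (g_sigma_preimage (fun (i : 'I_n) (x : 'rV[R]_n) => x ord0 i))
    ([set: T] `&` f @^-1` A) by exists A.
rewrite -g_sigma_preimage_comp; move: (_ `&` _).
apply: smallest_sub; first exact: sigma_algebra_measurable.
rewrite -bigcup_seq; apply: bigcup_sub => i _ B [C mC <-].
exact: mf.
Qed.

Lemma open_measurable_rV (R : realType) (n : nat) (U : set 'rV[R]_n) :
  open U -> measurable U.
Proof.
move=> oU.
pose c (q : 'rV[rat]_n) : 'rV[R]_n := map_mx (@ratr R) q.
pose D := [set p : 'rV[rat]_n * nat | ball (c p.1) p.2.+1%:R^-1 `<=` U].
have -> : U = \bigcup_(p in D) ball (c p.1) p.2.+1%:R^-1.
  apply/seteqP; split; last by move=> x [p Dp /Dp].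
  move=> x Ux.
  have /nbhs_ballP[e /= e0 xeU] : nbhs x U by exact: open_nbhs_nbhs.
  have [k ke] : exists k : nat, k.+1%:R^-1 + k.+1%:R^-1 < e.
    exists (Num.truncn (2 / e)).
    have := truncnS_gt (2 / e).
    set m : R := _.+1%:R => mgt.
    have m0 : 0 < m by rewrite ltr0n.
    by rewrite -mulr2n -[_ *+ 2]mulr_natl ltr_pdivrMr// mulrC -ltr_pdivrMr.
  have k0 : 0 < k.+1%:R^-1 :> R by rewrite invr_gt0 ltr0n.
  have [q hq] : exists q : 'rV[rat]_n,
      forall i, `|x ord0 i - ratr (q ord0 i)| < k.+1%:R^-1.
    have H i : {q : rat | `|x ord0 i - ratr q| < k.+1%:R^-1}.
      apply/cid.
      have : x ord0 i - k.+1%:R^-1 < x ord0 i + k.+1%:R^-1.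
        by rewrite ltrD2l gtrN.
      move=> /rat_in_itvoo[q]; rewrite in_itv/= => /andP[h1 h2].
      by exists q; rewrite distrC ltr_distl h1 h2.
    by exists (\row_i sval (H i)) => i; rewrite mxE; exact: (svalP (H i)).
  have xq : ball (c q) k.+1%:R^-1 x.
    by split => // i j; rewrite mxE /ball/= ord1 distrC; exact: hq.
  exists (q, k) => //= y qy; apply: xeU.
  apply: (le_ball (ltW ke)).
  exact: ball_triangle (ball_sym xq) qy.
rewrite bigcup_mkcond.
apply: countable_bigcupT_measurable => // -[q k]; case: ifPn => [_|_]; last by [].
rewrite /=.
have -> : ball (c q) k.+1%:R^-1 =
    \bigcap_(i in [set: 'I_n])
      ((fun x : 'rV[R]_n => x ord0 i) @^-1` ball (c q ord0 i) k.+1%:R^-1).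
  apply/seteqP; split => [x [_ h] i _|x h]; first exact: h.
  by split=> [|i j]; [rewrite invr_gt0 ltr0n|rewrite ord1; exact: h].
apply: fin_bigcap_measurable => [|i _]; first exact: finite_finset.
 rewrite -[X in measurable X]setTI.
apply: measurable_coord => //; exact: measurable_ball.
Qed.

Definition rV_cons (R : realType) (n : nat) (p : R * 'rV[R]_n) : 'rV[R]_n.+1 :=
  row_mx (const_mx p.1 : 'rV_1) p.2.

Lemma measurable_rV_cons (R : realType) (n : nat) :
  measurable_fun [set: R * 'rV[R]_n] (@rV_cons R n).
Proof.
apply: measurable_fun_rV => i.
have [j|j] := split_ordP (i : 'I_(1 + n)).
  move=> ->; rewrite (_ : (fun _ => _) = fst)//.
  by apply/funext => p; rewrite /rV_cons (row_mxEl (const_mx _ : 'rV_1)) mxE.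
move=> ->; rewrite (_ : (fun _ => _) = (fun x : 'rV[R]_n => x ord0 j) \o snd).
  by apply: measurableT_comp => //; exact: measurable_coord.
by apply/funext => p; rewrite /rV_cons (row_mxEr (const_mx _ : 'rV_1)).
Qed.

Fixpoint leb (R : realType) (n : nat) : set 'rV[R]_n -> \bar R :=
  if n is m.+1 return set 'rV[R]_n -> \bar R then
    pushforward (lebesgue_measure \x @leb R m)%E (@rV_cons R m)
  else dirac (0 : 'rV[R]_0).
Arguments leb {R n} _.

(* The library's canonical sigma-finite structure on product_measure1 only fires
   for subprobabilities, hence this direct statement. *)
Lemma product_measure1_sigma_finite d1 d2 (T1 : measurableType d1)
    (T2 : measurableType d2) (R : realType)
    (m1 : {sigma_finite_measure set T1 -> \bar R})
    (m2 : {sigma_finite_measure set T2 -> \bar R}) :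
  sigma_finite setT (m1 \x m2)%E.
Proof.
have /sigma_finiteP[F [TF ndF Foo]] := sigma_finiteT m1.
have /sigma_finiteP[G [TG ndG Goo]] := sigma_finiteT m2.
exists (fun n => F n `*` G n).
  rewrite -setXTT TF TG predeqE => -[x y]; split.
    move=> [/= [n _ Fnx] [k _ Gky]]; exists (maxn n k) => //; split.
    - by move: x Fnx; exact/subsetPset/ndF/leq_maxl.
    - by move: y Gky; exact/subsetPset/ndG/leq_maxr.
  by move=> [n _ []/= ? ?]; split; exists n.
move=> k; have [? ?] := Foo k; have [? ?] := Goo k.
split; first exact: measurableX.
by rewrite product_measure1E// lte_mul_pinfty// ge0_fin_numE.
Qed.

Section with_sigma_finite.
Context d (T : measurableType d) (R : realType).
Variable mu : {measure set T -> \bar R}.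

Definition with_sigma_finite of sigma_finite setT mu : set T -> \bar R := mu.

Hypothesis mu_fin : sigma_finite setT mu.

HB.instance Definition _ := Measure.on (with_sigma_finite mu_fin).

HB.instance Definition _ :=
  Measure_isSigmaFinite.Build _ _ _ (with_sigma_finite mu_fin) mu_fin.

End with_sigma_finite.

Section leb_measure.
Local Open Scope ereal_scope.
Context (R : realType).

Definition rV_uncons n (x : 'rV[R]_n.+1) : R * 'rV[R]_n :=
  (x ord0 ord0, \row_j x ord0 (lift ord0 j)).

Lemma measurable_rV_uncons n : measurable_fun [set: 'rV[R]_n.+1] (@rV_uncons n).
Proof.
apply/measurable_fun_pairP; split; first exact: measurable_coord.
apply: measurable_fun_rV => i.
have := @measurable_coord R n.+1 (lift ord0 i).
by congr (measurable_fun _ _); apply/funext => x; rewrite /= mxE.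
Qed.

Lemma rV_cons0 n (p : R * 'rV[R]_n) : rV_cons p ord0 ord0 = p.1.
Proof.
rewrite /rV_cons (_ : ord0 = lshift n (ord0 : 'I_1)); last exact/val_inj.
by rewrite (row_mxEl (const_mx _ : 'rV_1)) mxE.
Qed.

Lemma rV_consS n (p : R * 'rV[R]_n) j : rV_cons p ord0 (lift ord0 j) = p.2 ord0 j.
Proof.
rewrite /rV_cons (_ : lift ord0 j = rshift 1 j); last exact/val_inj.
by rewrite (row_mxEr (const_mx _ : 'rV_1)).
Qed.

Lemma rV_consK n : cancel (@rV_cons R n) (@rV_uncons n).
Proof.
move=> [t x]; rewrite /rV_uncons rV_cons0; congr pair.
by apply/rowP => j; rewrite mxE rV_consS.
Qed.

Let leb_ex n : exists mu : {sigma_finite_measure set 'rV[R]_n -> \bar R},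
  @leb R n = mu :> (set 'rV[R]_n -> \bar R).
Proof.
elim: n => [|n [mu muE]].
  by exists (dirac (0%R : 'rV[R]_0) : {sigma_finite_measure set 'rV[R]_0 -> \bar R}).
rewrite /= muE.
pose m : {measure set (measurableTypeR R * 'rV[R]_n)%type -> \bar R} :=
  lebesgue_measure \x mu.
have m_fin : sigma_finite setT m by exact: product_measure1_sigma_finite.
pose nu : {measure set 'rV[R]_n.+1 -> \bar R} :=
  measure_function_pushforward__canonical__measure_function_Measure m
    (@measurable_rV_cons R n).
have nu_fin : sigma_finite setT nu.
  have [F FT mF] := m_fin.
  exists (fun k => @rV_uncons n @^-1` F k).
    by rewrite -preimage_bigcup -FT preimage_setT.
  move=> k; have [mFk Fk] := mF k; split.
    by rewrite -[X in measurable X]setTI; exact: measurable_rV_uncons.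
  rewrite /nu/= /pushforward -comp_preimage.
  by rewrite (_ : _ \o _ = id)//; apply/funext => p; exact: rV_consK.
by exists (with_sigma_finite nu_fin).
Qed.

Variable n : nat.

Let leb0 : @leb R n set0 = 0.
Proof. by have [mu ->] := leb_ex n; rewrite measure0. Qed.

Let leb_ge0 A : 0 <= @leb R n A.
Proof. by have [mu ->] := leb_ex n. Qed.

Let leb_sigma_additive : semi_sigma_additive (@leb R n).
Proof. by have [mu ->] := leb_ex n; exact: measure_semi_sigma_additive. Qed.

HB.instance Definition _ := isMeasure.Build _ _ _ (@leb R n)
  leb0 leb_ge0 leb_sigma_additive.

Let leb_sigma_finite : sigma_finite setT (@leb R n).
Proof. by have [mu ->] := leb_ex n; exact: sigma_finiteT. Qed.

HB.instance Definition _ := Measure_isSigmaFinite.Build _ _ _ (@leb R n)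
  leb_sigma_finite.

End leb_measure.

Lemma leb_box (R : realType) (n : nat) (A : 'I_n -> set R) :
  (forall i, measurable (A i)) ->
  leb [set x : 'rV[R]_n | forall i, A i (x ord0 i)] =
  (\prod_(i < n) lebesgue_measure (A i))%E.
Proof.
elim: n A => [|n IH] A mA.
  by rewrite big_ord0 /= diracE mem_set// => -[].
rewrite big_ord_recl -IH//= /pushforward -product_measure1E//.
- congr product_measure1; apply/seteqP; split => -[t x]/= => [h|[h0 h] i].
    by split => [|i]; [have := h ord0|have := h (lift ord0 i)];
      rewrite ?rV_cons0 ?rV_consS.
  have [j ->|->] := unliftP ord0 i; last by rewrite rV_cons0.
  by rewrite rV_consS; exact: h.
- exact: mA.
- set B := (X in measurable X).
  have -> : B = \bigcap_(i in [set: 'I_n])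
      ((fun x : 'rV[R]_n => x ord0 i) @^-1` A (lift ord0 i)).
    by apply/seteqP; split => [x h i _|x h i]; exact: h.
  apply: fin_bigcap_measurable => [|i _]; first exact: finite_finset.
  by rewrite -[X in measurable X]setTI; exact: measurable_coord.
Qed.

Section sobolev.
Context {R : realType} {n : nat}.
Implicit Types (Omega : set 'rV[R]_n) (u phi f : 'rV[R]_n -> R).
Implicit Types g : 'rV[R]_n -> 'rV[R]_n.

(* Squared Euclidean norm; the library's norm on 'rV[R]_n is the sup norm. *)
Definition sqnorm (v : 'rV[R]_n) : R := \sum_(i < n) v ord0 i ^+ 2.

Definition partial (i : 'I_n) f : 'rV[R]_n -> R :=
  fun x => 'D_(delta_mx ord0 i) f x.

Definition grad f : 'rV[R]_n -> 'rV[R]_n := fun x => \row_i partial i f x.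

Definition iter_partial (s : seq 'I_n) f : 'rV[R]_n -> R := foldr partial f s.

Definition smooth f : Prop := forall s : seq 'I_n,
  continuous (iter_partial s f) /\
  forall (i : 'I_n) (x : 'rV[R]_n),
    derivable (iter_partial s f) x (delta_mx ord0 i).

Definition tsupport f : set 'rV[R]_n := closure [set x | f x != 0].

(* $C_c^\infty(\Omega)$, each function being extended by 0 to the whole space *)
Definition test_function Omega phi : Prop :=
  [/\ smooth phi, compact (tsupport phi) & tsupport phi `<=` Omega].

Definition L2 Omega u : Prop :=
  measurable_fun Omega u /\
  (\int[leb]_(x in Omega) (u x ^+ 2)%:E < +oo)%E.

Definition weak_gradient Omega u g : Prop :=
  forall phi, test_function Omega phi -> forall i : 'I_n,
    \int[leb]_(x in Omega) (u x * partial i phi x) =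
    - \int[leb]_(x in Omega) (g x ord0 i * phi x).

(* [H1 Omega u g]: u belongs to $H^1(\Omega)$ and g is (a representative of)
   its weak gradient. Functions are only relevant through their values on
   Omega, up to almost everywhere equality. *)
Definition H1 Omega u g : Prop :=
  [/\ L2 Omega u, forall i : 'I_n, L2 Omega (fun x => g x ord0 i)
    & weak_gradient Omega u g].

Definition H1_sqnorm Omega u g : \bar R :=
  (\int[leb]_(x in Omega) (u x ^+ 2)%:E +
   \int[leb]_(x in Omega) (sqnorm (g x))%:E)%E.

(* [H10 Omega u g]: moreover u belongs to $H^1_0(\Omega)$, the closure of
   $C_c^\infty(\Omega)$ in $H^1(\Omega)$. *)
Definition H10 Omega u g : Prop :=
  H1 Omega u g /\
  forall e : R, 0 < e -> exists phi, test_function Omega phi /\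
    (H1_sqnorm Omega (fun x => u x - phi x)%R
                     (fun x => g x - grad phi x)%R < e%:E)%E.

(* At the pole x = a i the quotient is 0 since 0^-1 = 0; this is a null set. *)
Definition hardy_inequality Omega m (a : 'I_m -> 'rV[R]_n) (gamma : 'I_m -> R)
    (C : R) : Prop :=
  forall u g, H10 Omega u g ->
  (C%:E * \sum_(i < m)
     \int[leb]_(x in Omega) (gamma i * (`|u x| ^+ 2 / sqnorm (x - a i)))%:E
   <= \int[leb]_(x in Omega) (sqnorm (g x))%:E)%E.

Definition sharp_hardy_constant Omega m (a : 'I_m -> 'rV[R]_n)
    (gamma : 'I_m -> R) (C : R) : Prop :=
  hardy_inequality Omega a gamma C /\
  forall C' : R, hardy_inequality Omega a gamma C' -> C' <= C.

End sobolev.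

(* Main.v *)
Require Import Defs.
From HB Require Import structures.
From mathcomp Require Import all_boot all_order all_algebra.
From mathcomp Require Import all_classical all_reals all_analysis.
From mathcomp Require Import ring lra.

(** Write [H = (N-2)^2/4], [k = (N-2)/2] and [q_i = |x - a_i|^2].

    For the strict lower bound it suffices to exhibit one constant [C'] with
    [C' * \sum gamma_i > H] for which the inequality holds. For a smooth vector
    field [V] and a test function [f], expanding [|grad f + f V|^2 >= 0] and
    integrating [div (f^2 V)] to zero gives
    [\int |grad f|^2 >= \int (div V - |V|^2) f^2]
    ([test_hardy_vector_field]). Take for [V] the convex combination, with
    weights [mu_i = gamma_i / \sum gamma], of the fields
    [k (x - a_i) / (q_i + eta)]; each of them, as [eta -> 0], yields the one-pole
    Hardy inequality with constant [H]. The square is strictly convex, so the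
    mixture gains
    [k^2/2 \sum_(i, l) mu_i mu_l |a_i - a_l|^2 / ((q_i + eta)(q_l + eta))].
    On a bounded domain one of the two factors of each summand is bounded
    below, and since there are two distinct poles the gain dominates a positive
    multiple of [\sum mu_i / (q_i + eta)] ([multipole_pointwise]). Density
    extends this to [H^1_0] for fixed [eta], the weight being bounded
    ([H10_hardy_bounded]), and monotone convergence removes [eta]
    ([H10_hardy_nondecreasing], [multipole_hardy_improved]).

    For the upper bound at a single pole, test with
    [(q_i + eta)^(-k/2) * exp (-1 / (rho^2 - q_i))], extended by 0,
    which is smooth and supported in a small ball. Its gradient squared is at most [(k^2 + eps) f^2 / q_i + K],
    with [K] independent of [eta] ([grad_pole_profile_le]), whereas
    [\int f^2 / q_i], which behaves like [\int |x - a_i|^(-N)], is unbounded as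
    [eta -> 0] ([pole_profile_integral_unbounded]). Hence no constant
    [C gamma_i > k^2] is admissible ([hardy_inequality_pole_le]).

    The integral of a partial derivative of a test function vanishes by Fubini
    and the fundamental theorem of calculus ([integral_partial0]); smoothness of
    all the functions involved is obtained by showing that they lie in an
    algebra stable under partial derivatives ([generated_alg_smooth],
    [smooth_comp]). *)

Import Order.TTheory GRing.Theory Num.Theory.
Import numFieldNormedType.Exports.

Local Open Scope classical_set_scope.
Local Open Scope ring_scope.

Set Implicit Arguments.
Unset Strict Implicit.
Unset Printing Implicit Defensive.

(** * Partial derivatives integrate to zero *)

(** A directional derivative only sees the function on a line, so it can be
    transported between functions, possibly on different spaces, that agree on
    corresponding lines. This covers slices and restrictions to lines. *)
Lemma is_derive_along (R : realType) (V W U : normedModType R)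
    (f : V -> U) (g : W -> U) (x v : V) (y w : W) (d : U) :
  (forall h : R, g (h *: w + y) = f (h *: v + x)) ->
  is_derive x v f d -> is_derive y w g d.
Proof.
move=> fg [df Df].
have g0 : g y = f x by have := fg 0; rewrite !scale0r !add0r.
have E : (fun h => h^-1 *: (g (h *: w + y) - g y)) =
         (fun h => h^-1 *: (f (h *: v + x) - f x)).
  by apply/funext => h; rewrite fg g0.
split; first by rewrite /derivable /= /comp /= [X in cvg (nbhs (X @ _))]E.
by rewrite -Df /derive /= /comp /= [X in lim (nbhs (X @ _))]E.
Qed.

Lemma continuous_measurable_rV (R : realType) (n : nat) (f : 'rV[R]_n -> R) :
  continuous f -> measurable_fun [set: 'rV[R]_n] f.
Proof.
move=> cf; apply: (measurability _ (RGenOpens.measurableE R)).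
move=> _ [_ [a [b ->] <-]].
rewrite setTI; apply: open_measurable_rV; apply: open_comp; last exact: interval_open.
by move=> x _; exact: cf.
Qed.

Lemma measurable_bounded_support_integrable (R : realType) (n : nat)
    (f : 'rV[R]_n -> R) (B M : R) (D : set 'rV[R]_n) :
  measurable D -> measurable_fun D f -> (forall x, D x -> `|f x| <= B) ->
  (forall x, D x -> f x != 0 -> forall j, `|x ord0 j| <= M) ->
  leb.-integrable D (EFin \o f).
Proof.
move=> mD mf fB fM.
pose box := [set x : 'rV[R]_n | forall j, `[-M, M]%classic (x ord0 j)].
have mbox : measurable box.
  have -> : box = \bigcap_(i in [set: 'I_n])
      ((fun x : 'rV[R]_n => x ord0 i) @^-1` `[-M, M]).
    by apply/seteqP; split => [x h i _|x h i]; exact: h.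
  apply: fin_bigcap_measurable => [|i _]; first exact: finite_finset.
  by rewrite -[X in measurable X]setTI; exact: measurable_coord.
have bfin : (leb box < +oo)%E.
  rewrite /box (leb_box (A := fun _ => `[-M, M]%classic))// ltey_eq.
  suff -> : (\prod_(i < n) lebesgue_measure `[(- M)%R, M] \is a fin_num)%E by [].
  apply: (big_ind (fun z => z \is a fin_num)) => //.
    by move=> x y; exact: fin_numM.
  by move=> i _; rewrite lebesgue_measure_itv /=; case: ifPn.
have iB : leb.-integrable box (EFin \o cst B).
  apply: measurable_bounded_integrable => //.
  exists `|B|; split; first by rewrite realE normr_ge0.
  by move=> z Bz x _ /=; exact: ltW.
have : leb.-integrable D ((EFin \o cst B) \_ box).
  apply: (@integrableS _ _ _ _ setT) => //.
  by apply/(integrable_mkcond _ mbox).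
apply: le_integrable => //; first exact/measurable_EFinP.
move=> x Dx; rewrite patchE; case: ifPn => [_|nb] /=.
  by rewrite lee_fin (le_trans (fB x Dx)) ?ler_norm.
rewrite normr0 lee_fin normr_le0; apply: contraNT nb => /(fM x Dx) h.
by rewrite inE => j /=; rewrite in_itv /= -ler_norml.
Qed.

Lemma rV_cons_line0 (R : realType) (n : nat) (t h : R) (y : 'rV[R]_n) :
  rV_cons (h *: 1 + t, y) = h *: delta_mx ord0 ord0 + rV_cons (t, y).
Proof.
apply/rowP => j; rewrite [RHS]mxE.
have [k ->|->] := unliftP ord0 j.
  by rewrite !rV_consS mxE mxE /= mulr0 add0r.
by rewrite !rV_cons0 mxE mxE.
Qed.

Lemma rV_cons_lineS (R : realType) (n : nat) (t h : R) (i : 'I_n) (y : 'rV[R]_n) :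
  rV_cons (t, h *: delta_mx ord0 i + y) =
  h *: delta_mx ord0 (lift ord0 i) + rV_cons (t, y).
Proof.
apply/rowP => j; rewrite [RHS]mxE.
have [k ->|->] := unliftP ord0 j.
  by rewrite !rV_consS !mxE /= (inj_eq lift_inj).
by rewrite !rV_cons0 mxE mxE /= mulr0 add0r.
Qed.

Lemma continuous_rV (R : realType) (n : nat) (T : topologicalType) (f : T -> 'rV[R]_n) :
  (forall i, continuous (fun t => f t ord0 i)) -> continuous f.
Proof.
move=> cf x; apply/cvg_ballP => e e0.
have : \forall t \near x, forall i, ball (f x ord0 i) e (f t ord0 i).
  apply: filter_forall => i; have /cvg_ballP := cf i x; exact.
by apply: filterS => t h; split=> // i j; rewrite ord1; exact: h.
Qed.

Lemma integral_compact_derive0 (R : realType) (M : R) (f df : R -> R) :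
  continuous df -> (forall x : R, is_derive x 1 f (df x)) ->
  (forall x, M < `|x| -> f x = 0 /\ df x = 0) ->
  (\int[lebesgue_measure]_x (df x)%:E = 0)%E.
Proof.
move=> cdf fdf fM.
pose K : R := `|M| + 1.
have K0 : 0 < K by rewrite ltr_wpDl.
have MK (x : R) : K <= `|x| -> M < `|x|.
  by apply: lt_le_trans; rewrite (le_lt_trans (ler_norm M))// ltrDl.
transitivity (\int[lebesgue_measure]_(x in `[(- K)%R, K]) (df x)%:E)%E.
  rewrite [RHS]integral_mkcond; apply: eq_integral => x _.
  rewrite patchE; case: ifPn => // nK.
  have [] := fM x; last by move=> _ ->.
  apply: MK; rewrite leNgt; apply: contra nK => xK.
  by rewrite inE /= in_itv /= -ler_norml ltW.
have cf : continuous f.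
  move=> x; apply: differentiable_continuous; apply/derivable1_diffP.
  by have [] := fdf x.
rewrite (@continuous_FTC2 _ df f).
- have [-> _] := fM K (MK _ (ler_norm _)).
  have [|-> _] := fM (- K); first by apply: MK; rewrite normrN ler_norm.
  by rewrite subee.
- by rewrite gtrN.
- exact: continuous_subspaceT.
- split.
  + by move=> x _; have [] := fdf x.
  + exact/cvg_at_right_filter/cf.
  + exact/cvg_at_left_filter/cf.
- by move=> x _; have [_ <-] := fdf x; rewrite derive1E.
Qed.

Lemma continuous_rV_cons2 (R : realType) (n : nat) (t : R) :
  continuous (fun y : 'rV[R]_n => rV_cons (t, y)).
Proof.
apply: continuous_rV => i; have [k ->|->] := unliftP ord0 i.
  under [X in continuous X]funext do rewrite rV_consS.
  exact: coord_continuous.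
under [X in continuous X]funext do rewrite rV_cons0.
exact: cst_continuous.
Qed.

Lemma continuous_rV_cons1 (R : realType) (n : nat) (y : 'rV[R]_n) :
  continuous (fun t : R => rV_cons (t, y)).
Proof.
apply: continuous_rV => i; have [k ->|->] := unliftP ord0 i.
  under [X in continuous X]funext do rewrite rV_consS.
  exact: cst_continuous.
by under [X in continuous X]funext do rewrite rV_cons0.
Qed.

(** By induction on the dimension, splitting off the first coordinate with
    Fubini. In the direction of the first coordinate the inner integral is
    one-dimensional; in any other direction the inner integral is an instance
    of the induction hypothesis for a slice of [f]. *)
Lemma integral_partial0 (R : realType) (n : nat) (i : 'I_n) (B M : R)
    (f df : 'rV[R]_n -> R) :
  continuous df -> (forall x, `|df x| <= B) ->
  (forall x, is_derive x (delta_mx ord0 i) f (df x)) ->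
  (forall (x : 'rV[R]_n) j, M < `|x ord0 j| -> f x = 0 /\ df x = 0) ->
  (\int[leb]_x (df x)%:E = 0)%E.
Proof.
elim: n i f df => [[]//|n IH] i f df cdf dfB fdf fM.
have mdf : measurable_fun setT (EFin \o df).
  by apply/measurable_EFinP; exact: continuous_measurable_rV.
have idf : leb.-integrable setT (EFin \o df).
  apply: (@measurable_bounded_support_integrable _ _ _ B M) => //.
    exact: continuous_measurable_rV.
  move=> x _ + j; rewrite leNgt; apply: contra => /fM[_ ->]//.
pose m : {measure set (measurableTypeR R * 'rV[R]_n)%type -> \bar R} :=
  (lebesgue_measure \x @leb R n)%E.
have mcons : measurable_fun [set: (measurableTypeR R * 'rV[R]_n)%type] (@rV_cons R n).
  exact: measurable_rV_cons.
have ip : m.-integrable setT ((EFin \o df) \o @rV_cons R n).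
  have /integrableP[_ h] := idf; apply/integrableP; split.
    by apply: measurableT_comp => //; exact: mcons.
  move: h; rewrite (@ge0_integral_pushforward _ _ _ _ _ _ mcons m).
  - by rewrite preimage_setT.
  - exact: measurableT.
  - exact: measurableT_comp.
  - by move=> x _ /=.
transitivity (\int[m]_p (df (rV_cons p))%:E)%E.
  rewrite (@integral_pushforward _ _ _ _ _ _ mcons m (@setT _) (EFin \o df)).
  - by rewrite preimage_setT.
  - exact: mdf.
  - by rewrite preimage_setT.
  - exact: measurableT.
have [k ik|i0] := unliftP ord0 i.
  rewrite -(integral12_prod_meas1 ip).
  apply: integral0_eq => t _; rewrite /fubini_F /=.
  apply: (IH k (fun y => f (rV_cons (t, y)))).
  - move=> y; apply: continuous_comp; [exact: continuous_rV_cons2|exact: cdf].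
  - by move=> y; exact: dfB.
  - move=> y; apply: (@is_derive_along _ _ _ _ f _ (rV_cons (t, y)) (delta_mx ord0 i)) => //.
    by move=> h; rewrite ik rV_cons_lineS.
  - by move=> y j; rewrite -(rV_consS (t, y)); exact: fM.
rewrite -(integral21_prod_meas1 ip).
apply: integral0_eq => y _; rewrite /fubini_G /=.
apply: (@integral_compact_derive0 _ M (fun t => f (rV_cons (t, y)))).
- move=> t; apply: continuous_comp; [exact: continuous_rV_cons1|exact: cdf].
- move=> t; apply: (@is_derive_along _ _ _ _ f _ (rV_cons (t, y)) (delta_mx ord0 i)) => //.
  by move=> h; rewrite i0 rV_cons_line0.
- by move=> t h; apply: (fM _ ord0); rewrite rV_cons0.
Qed.

(** * Smooth functions and test functions *)

(** The iterated partial derivatives of a product or of a composite have no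
    convenient closed form, but they all stay in the algebra generated by a
    family whose first derivatives lie in that algebra. *)
Inductive generated_alg (R : realType) (n : nat) (G : set ('rV[R]_n -> R)) :
    ('rV[R]_n -> R) -> Prop :=
| alg_gen f : G f -> generated_alg G f
| alg_cst c : generated_alg G (cst c)
| alg_coord i : generated_alg G (fun x => x ord0 i)
| alg_add f g : generated_alg G f -> generated_alg G g -> generated_alg G (f + g)
| alg_mul f g : generated_alg G f -> generated_alg G g -> generated_alg G (f * g).

Lemma is_derive_coord (R : realType) (n : nat) (i : 'I_n) (x v : 'rV[R]_n) :
  is_derive x v (fun x : 'rV[R]_n => x ord0 i) (v ord0 i).
Proof.
apply: (@is_derive_along R R _ R (fun t : R => t * v ord0 i + x ord0 i) _ 0 1) => [h|].
  by rewrite !mxE addr0 /= [h *: 1]mulr1.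
have -> : (fun t : R => t * v ord0 i + x ord0 i) = (id * cst (v ord0 i)) + cst (x ord0 i).
  exact/funext.
apply: is_derive_eq.
by rewrite /= addr0 scaler0 add0r [_ *: 1]mulr1.
Qed.

Lemma partial_val (R : realType) (n : nat) (i : 'I_n) (x : 'rV[R]_n) f (d : R) :
  is_derive x (delta_mx ord0 i) f d -> partial i f x = d.
Proof. by case. Qed.

Lemma bounded_coord (R : realType) (n : nat) (Omega : set 'rV[R]_n) :
  bounded_set Omega -> exists M, forall x, Omega x -> forall j, `|x ord0 j| <= M.
Proof.
move=> [M [_ MK]]; exists (M + 1) => x Kx j.
apply: le_trans (MK (M + 1) _ x Kx); last by rewrite ltrDl.
have : `|x| <= `|x| by [].
by rewrite {1}[`|x|]mx_normrE => /bigmax_leP[_ /(_ (ord0, j) isT)].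
Qed.

Section smoothness.
Variables (R : realType) (n : nat).
Implicit Types (f g : 'rV[R]_n -> R) (G : set ('rV[R]_n -> R)).

Lemma smooth_continuous f : smooth f -> continuous f.
Proof. by move=> /(_ [::])[]. Qed.

Lemma smooth_derivable f i x : smooth f -> derivable f x (delta_mx ord0 i).
Proof. by move=> /(_ [::])[_]; exact. Qed.

Lemma smooth_is_derive f i x :
  smooth f -> is_derive x (delta_mx ord0 i) f (partial i f x).
Proof. by move=> sf; apply: derivableP; exact: smooth_derivable. Qed.

Lemma smooth_partial f i : smooth f -> smooth (partial i f).
Proof.
by move=> sf s; rewrite /iter_partial -(foldr_rcons (@partial R n)); exact: sf.
Qed.

Lemma generated_alg_smooth G :
  (forall f, G f -> continuous f) ->
  (forall f i, G f -> exists2 df, generated_alg G df &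
     forall x, is_derive x (delta_mx ord0 i) f (df x)) ->
  forall f, generated_alg G f -> smooth f.
Proof.
move=> Gc Gd.
have cG f : generated_alg G f -> continuous f.
  elim=> {f} [f /Gc//|c|i|f g _ cf _ cg|f g _ cf _ cg].
  - exact: cst_continuous.
  - exact: coord_continuous.
  - by move=> x; apply: continuousD; [exact: cf|exact: cg].
  - by move=> x; apply: continuousM; [exact: cf|exact: cg].
have dG f i : generated_alg G f -> exists2 df, generated_alg G df &
     forall x, is_derive x (delta_mx ord0 i) f (df x).
  elim=> {f} [f /(Gd f i)//|c|j|f g _ [df Gdf fdf] _ [dg Gdg gdg]|
              f g Gf [df Gdf fdf] Gg [dg Gdg gdg]].
  - by exists (cst 0); [exact: alg_cst|move=> x; exact: is_derive_cst].
  - exists (cst ((delta_mx ord0 i : 'rV[R]_n) ord0 j)); first exact: alg_cst.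
    by move=> x; exact: is_derive_coord.
  - by exists (df + dg); [exact: alg_add|move=> x; exact: is_deriveD].
  - exists (f * dg + g * df); first by apply: alg_add; exact: alg_mul.
    by move=> x; exact: is_deriveM.
have pG f i : generated_alg G f -> generated_alg G (partial i f).
  move=> /(dG f i)[df Gdf fdf]; suff -> : partial i f = df by [].
  by apply/funext => x; exact: partial_val.
move=> f Gf s.
have Gs : generated_alg G (iter_partial s f) by elim: s => //= i s; exact: pG.
split; first exact: cG.
by move=> i x; have [df _ /(_ x)[]] := dG _ i Gs.
Qed.

(** Closure of smooth functions under sums and products at once, since the
    smooth functions themselves form a family stable under derivatives. *)
Lemma smooth_alg f : generated_alg smooth f -> smooth f.
Proof.
apply: generated_alg_smooth => [g /smooth_continuous//|g i sg].
exists (partial i g); first by apply: alg_gen; exact: smooth_partial.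
by move=> x; exact: smooth_is_derive.
Qed.

Lemma smoothM f g : smooth f -> smooth g -> smooth (f * g).
Proof. by move=> sf sg; apply: smooth_alg; apply: alg_mul; exact: alg_gen. Qed.

Lemma partialM f g i x : smooth f -> smooth g ->
  partial i (f * g) x = f x * partial i g x + g x * partial i f x.
Proof.
move=> sf sg; apply: partial_val; apply: is_deriveM; exact: smooth_is_derive.
Qed.

Lemma notin_tsupport f x : ~ tsupport f x -> \forall y \near x, f y = 0.
Proof.
move=> nfx; have : nbhs x (~` tsupport f) by apply: open_nbhs_nbhs; split=> //; apply: closed_openC; exact: closed_closure.
apply: filterS => y nfy; apply: contrapT => /eqP fy; apply: nfy.
exact: subset_closure.
Qed.

Lemma tsupport0 f x : ~ tsupport f x -> f x = 0.
Proof. by move/notin_tsupport/nbhs_singleton. Qed.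

Lemma partial_tsupport0 f x i : ~ tsupport f x -> partial i f x = 0.
Proof.
move=> nfx; rewrite /partial -(@near_eq_derive R _ _ (cst 0) f x).
  exact: derive_cst.
by have := notin_tsupport nfx; apply: filterS => y ->.
Qed.

Lemma compact_support_bounded (K : set 'rV[R]_n) f : compact K ->
  continuous f -> (forall x, ~ K x -> f x = 0) -> exists B, forall x, `|f x| <= B.
Proof.
move=> cK cf f0.
have : compact (f @` K) by apply: continuous_compact => //; exact: continuous_subspaceT.
move=> /compact_bounded[M [_ MK]]; exists (`|M| + 1) => x.
have [Kx|/f0 ->] := pselect (K x); last by rewrite normr0 addr_ge0.
by apply: MK; [rewrite (le_lt_trans (ler_norm M))// ltrDl|exists x].
Qed.

Lemma compact_support_integrable (K D : set 'rV[R]_n) f : measurable D -> compact K ->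
  continuous f -> (forall x, ~ K x -> f x = 0) -> leb.-integrable D (EFin \o f).
Proof.
move=> mD cK cf f0.
have [B fB] := compact_support_bounded cK cf f0.
have [M KM] := bounded_coord (compact_bounded cK).
apply: (@measurable_bounded_support_integrable _ _ _ B M) => //.
  by apply: measurable_funTS; exact: continuous_measurable_rV.
move=> x _ fx; apply: KM; apply: contrapT => /f0 fx0.
by rewrite fx0 eqxx in fx.
Qed.

Variable Omega : set 'rV[R]_n.
Hypothesis oOmega : open Omega.

Let mOmega : measurable Omega. Proof. exact: open_measurable_rV. Qed.

Lemma test_integral_partial0 f i : test_function Omega f ->
  (\int[leb]_(x in Omega) (partial i f x)%:E = 0)%E.
Proof.
move=> [sf cf fO].
have cdf : continuous (partial i f) by apply/smooth_continuous/smooth_partial.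
have [B dfB] := compact_support_bounded cf cdf (@partial_tsupport0 f ^~ i).
have [M KM] := bounded_coord (compact_bounded cf).
have <- : (\int[leb]_x (partial i f x)%:E = 0)%E.
  apply: (@integral_partial0 R n i B M f) => //.
    by move=> x; exact: smooth_is_derive.
  move=> x j Mx; have nfx : ~ tsupport f x.
    by move=> /KM/(_ j); rewrite leNgt Mx.
  by rewrite tsupport0// partial_tsupport0.
rewrite integral_mkcond; apply: eq_integral => x _; rewrite patchE.
case: ifPn => // /negP nOx; rewrite partial_tsupport0// => /fO Ox.
by apply: nOx; rewrite inE.
Qed.

Lemma tsupportM f g : tsupport (f * g) `<=` tsupport f.
Proof.
apply: closureS => x /=; apply: contra => /eqP fx.
by rewrite /GRing.mul /= fx mul0r.
Qed.

Lemma test_functionM f g : test_function Omega f -> smooth g -> test_function Omega (f * g).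
Proof.
move=> [sf cf fO] sg; split; first exact: smoothM.
- apply: subclosed_compact cf (@tsupportM f g); exact: closed_closure.
- exact: subset_trans (@tsupportM f g) fO.
Qed.

(** Integration by parts: [partial i (f * g)] integrates to zero. *)
Lemma test_weak_gradient f : test_function Omega f -> weak_gradient Omega f (grad f).
Proof.
move=> tf g tg i; have [sf cf _] := tf; have [sg cg _] := tg.
have := test_integral_partial0 i (test_functionM tf sg).
under eq_integral do rewrite (partialM _ _ sf sg) EFinD.
have i1 : leb.-integrable Omega (EFin \o (fun x => f x * partial i g x)).
  apply: (compact_support_integrable mOmega cf).
    by move=> x; apply: continuousM; apply: smooth_continuous => //; exact: smooth_partial.
  by move=> x nf; rewrite tsupport0// mul0r.
have i2 : leb.-integrable Omega (EFin \o (fun x => g x * partial i f x)).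
  apply: (compact_support_integrable mOmega cg).
    by move=> x; apply: continuousM; apply: smooth_continuous => //; exact: smooth_partial.
  by move=> x nf; rewrite tsupport0// mul0r.
rewrite integralD// => E.
rewrite /Rintegral.
under [in RHS]eq_integral do rewrite mxE mulrC.
have := integrable_fin_num mOmega i1; have := integrable_fin_num mOmega i2.
move: E; rewrite /comp.
move: (\int[leb]_(x in Omega) _)%E => a; move: (\int[leb]_(x in Omega) _)%E => b.
case: a => [a| |]//; case: b => [b| |]// [] /eqP; rewrite addr_eq0 => /eqP -> _ _ //=.
Qed.

Lemma test_L2 (K : set 'rV[R]_n) f : compact K ->
  continuous f -> (forall x, ~ K x -> f x = 0) -> L2 Omega f.
Proof.
move=> cK cf f0; split.
  by apply: measurable_funTS; exact: continuous_measurable_rV.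
have /integrableP[_] : leb.-integrable Omega (EFin \o (fun x => f x ^+ 2)).
  apply: (compact_support_integrable mOmega cK) => [|x /f0 ->].
    by move=> x; apply: continuousM; exact: cf.
  by rewrite expr0n.
apply: le_lt_trans; rewrite le_eqVlt; apply/orP; left; apply/eqP.
by apply: eq_integral => x _ /=; rewrite ger0_norm ?sqr_ge0.
Qed.

Lemma test_H10 f : test_function Omega f -> H10 Omega f (grad f).
Proof.
move=> tf; have [sf cf _] := tf; split; last first.
  move=> e e0; exists f; split => //.
  rewrite /H1_sqnorm !integral0_eq ?adde0//.
  - move=> x _; rewrite subrr /sqnorm big1// => i _; by rewrite mxE expr0n.
  - by move=> x _; rewrite subrr expr0n.
split.
- apply: test_L2 cf _ (@tsupport0 f); exact: smooth_continuous.
- move=> i; under [X in L2 _ X]funext do rewrite mxE.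
  apply: test_L2 cf _ (@partial_tsupport0 f ^~ i).
  by apply: smooth_continuous; exact: smooth_partial.
- exact: test_weak_gradient.
Qed.
End smoothness.

(** * Smoothness of compositions and of powers of the distance *)

Lemma is_derive_comp_real (R : realType) (V : normedModType R) (q : V -> R) (h : R -> R)
    (x v : V) (dq dh : R) :
  is_derive x v q dq -> is_derive (q x) 1 h dh -> is_derive x v (h \o q) (dh * dq).
Proof.
move=> Dq Dh.
have D0 : is_derive (0 : R) 1 (fun t : R => q (t *: v + x)) dq.
  apply: (@is_derive_along _ _ _ _ q _ x v) Dq => t.
  by rewrite addr0 [t *: 1]mulr1.
have D1 : is_derive (0 : R) 1 (h \o (fun t : R => q (t *: v + x))) (dh * dq).
  by apply: is_derive1_comp; rewrite /= scale0r add0r.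
apply: (@is_derive_along _ _ _ _ _ _ (0 : R) 1) D1 => t /=.
by rewrite addr0 [t *: 1]mulr1.
Qed.

Lemma is_derive_continuous1 (R : realType) (h : R -> R) (t d : R) :
  is_derive t 1 h d -> {for t, continuous h}.
Proof.
by move=> [Dh _]; apply: differentiable_continuous; apply/derivable1_diffP.
Qed.

(** It suffices that [h] belongs to a family of functions of one variable in
    which each derivative is a combination of two members. Two terms are enough
    for the powers [t `^ p] and for the functions [t^-m exp (- 1/t)] below. *)
Lemma smooth_comp (R : realType) (n : nat) (q : 'rV[R]_n -> R) (S : set (R -> R)) :
  smooth q ->
  (forall h, S h -> exists c1 c2 h1 h2, [/\ S h1, S h2 &
     forall x, is_derive (q x) 1 h (c1 * h1 (q x) + c2 * h2 (q x))]) ->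
  forall h, S h -> smooth (h \o q).
Proof.
move=> sq Sd h Sh.
pose G := [set f | smooth f \/ exists2 h, S h & f = h \o q].
suff : generated_alg G (h \o q).
  apply: generated_alg_smooth => [f [/smooth_continuous//|[k Sk ->]]|f i [sf|[k Sk ->]]].
  - have [c1 [c2 [h1 [h2 [_ _ kd]]]]] := Sd _ Sk.
    move=> x; apply: continuous_comp; first exact: smooth_continuous.
    exact: is_derive_continuous1 (kd x).
  - exists (partial i f); last by move=> x; exact: smooth_is_derive.
    by apply: alg_gen; left; exact: smooth_partial.
  - have [c1 [c2 [h1 [h2 [S1 S2 kd]]]]] := Sd _ Sk.
    exists ((cst c1 * (h1 \o q) + cst c2 * (h2 \o q)) * partial i q).
      apply: alg_mul; last by apply: alg_gen; left; exact: smooth_partial.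
      by apply: alg_add; apply: alg_mul; [exact: alg_cst| |exact: alg_cst|];
        apply: alg_gen; right; [exists h1|exists h2].
    by move=> x; apply: is_derive_comp_real => //; exact: smooth_is_derive.
by apply: alg_gen; right; exists h.
Qed.

Section smooth_ops.
Variables (R : realType) (n : nat).
Implicit Types (f g : 'rV[R]_n -> R).

Lemma smooth_cst (c : R) : smooth (cst c : 'rV[R]_n -> R).
Proof. by apply: smooth_alg; exact: alg_cst. Qed.

Lemma smooth_coord i : smooth (fun x : 'rV[R]_n => x ord0 i).
Proof. by apply: smooth_alg; exact: alg_coord. Qed.

Lemma smoothD f g : smooth f -> smooth g -> smooth (f + g).
Proof. by move=> sf sg; apply: smooth_alg; apply: alg_add; exact: alg_gen. Qed.

Lemma smooth_sum (I : Type) (r : seq I) (F : I -> 'rV[R]_n -> R) :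
  (forall i, smooth (F i)) -> smooth (fun x => \sum_(i <- r) F i x).
Proof.
move=> sF; elim: r => [|i r IH].
  by under [X in smooth X]funext do rewrite big_nil; exact: smooth_cst.
under [X in smooth X]funext do rewrite big_cons.
exact: smoothD.
Qed.

Lemma is_derive_sum_fun (I : Type) (r : seq I) (F : I -> 'rV[R]_n -> R) (dF : I -> R) x v :
  (forall i, is_derive x v (F i) (dF i)) ->
  is_derive x v (fun x => \sum_(i <- r) F i x) (\sum_(i <- r) dF i).
Proof.
move=> sF; elim: r => [|i r IH].
  rewrite big_nil; under [X in is_derive _ _ X]funext do rewrite big_nil.
  exact: is_derive_cst.
rewrite big_cons; under [X in is_derive _ _ X]funext do rewrite big_cons.
exact: is_deriveD.
Qed.

Lemma smooth_shift_coord (a : 'rV[R]_n) i : smooth (fun x : 'rV[R]_n => x ord0 i - a ord0 i).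
Proof. exact: smoothD (smooth_coord i) (smooth_cst (- a ord0 i)). Qed.

Lemma is_derive_shift_coord (a : 'rV[R]_n) i (x v : 'rV[R]_n) :
  is_derive x v (fun x : 'rV[R]_n => x ord0 i - a ord0 i) (v ord0 i).
Proof.
have := is_deriveD (is_derive_coord i x v) (is_derive_cst (- a ord0 i) x v).
by rewrite addr0.
Qed.

Lemma sqnormE (x a : 'rV[R]_n) : sqnorm (x - a) = \sum_i (x ord0 i - a ord0 i) ^+ 2.
Proof. by apply: eq_bigr => i _; rewrite !mxE. Qed.

Lemma sqnorm_ge0 (x : 'rV[R]_n) : 0 <= sqnorm x.
Proof. by apply: sumr_ge0 => i _; exact: sqr_ge0. Qed.

Lemma smooth_sqnorm (a : 'rV[R]_n) : smooth (fun x => sqnorm (x - a)).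
Proof.
under [X in smooth X]funext do rewrite sqnormE.
apply: smooth_sum => i; under [X in smooth X]funext do rewrite expr2.
apply: (@smoothM _ _ (fun x => x ord0 i - a ord0 i)); exact: smooth_shift_coord.
Qed.

Lemma is_derive_sqnorm (a x : 'rV[R]_n) (j : 'I_n) :
  is_derive x (delta_mx ord0 j) (fun x => sqnorm (x - a)) (2 * (x ord0 j - a ord0 j)).
Proof.
under [X in is_derive _ _ X]funext do rewrite sqnormE.
have D i : is_derive x (delta_mx ord0 j) (fun x : 'rV[R]_n => (x ord0 i - a ord0 i) ^+ 2)
    (2 * (x ord0 i - a ord0 i) ^+ 1 * (delta_mx ord0 j : 'rV[R]_n) ord0 i).
  exact: (is_deriveX 2 (is_derive_shift_coord a i x (delta_mx ord0 j))).
apply: (is_derive_eq (is_derive_sum_fun (index_enum 'I_n) D)).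
rewrite (bigD1 j)//= big1 ?addr0.
  by rewrite !mxE !eqxx mulr1 /= expr1.
by move=> i ij; rewrite mxE (negbTE ij) andbF mulr0.
Qed.

Lemma smooth_powR_sqnorm (a : 'rV[R]_n) (eta p : R) : 0 < eta ->
  smooth (fun x => (sqnorm (x - a) + eta) `^ p).
Proof.
move=> eta0.
pose S := [set h | exists p : R, h = (fun t : R => t `^ p)].
pose q := (fun x => sqnorm (x - a)) + cst eta.
apply: (@smooth_comp _ _ q S _ _ (fun t : R => t `^ p)); last by exists p.
  exact: smoothD (smooth_sqnorm a) (smooth_cst eta).
move=> _ [r ->]; exists r, 0, (fun t : R => t `^ (r - 1)), (fun t : R => t `^ (r - 1)).
split; [by exists (r - 1)|by exists (r - 1)|move=> x].
rewrite mul0r addr0; apply: is_derive1_powR.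
by rewrite /q /= ltr_wpDl ?sqnorm_ge0.
Qed.

Lemma is_derive_powR_sqnorm (a : 'rV[R]_n) (eta p : R) (x : 'rV[R]_n) j : 0 < eta ->
  is_derive x (delta_mx ord0 j) (fun x => (sqnorm (x - a) + eta) `^ p)
   (p * (sqnorm (x - a) + eta) `^ (p - 1) * (2 * (x ord0 j - a ord0 j))).
Proof.
move=> eta0.
have D1 := is_deriveD (is_derive_sqnorm a x j) (is_derive_cst eta x (delta_mx ord0 j)).
rewrite addr0 in D1.
apply: (is_derive_comp_real (h := (fun t => t `^ p)) D1).
by apply: is_derive1_powR; rewrite /= ltr_wpDl ?sqnorm_ge0.
Qed.

End smooth_ops.

(** * Hardy inequalities from vector fields *)

Lemma ge0_integral_le_lincomb d (T : measurableType d) (R : realType)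
    (mu : {measure set T -> \bar R}) (D : set T) (a b c : T -> R) (k l : R) :
  measurable D -> measurable_fun D a -> measurable_fun D b -> measurable_fun D c ->
  (forall x, D x -> 0 <= a x) -> (forall x, D x -> 0 <= b x) ->
  (forall x, D x -> 0 <= c x) -> 0 <= k -> 0 <= l ->
  (forall x, D x -> a x <= k * b x + l * c x) ->
  (\int[mu]_(x in D) (a x)%:E <=
   k%:E * \int[mu]_(x in D) (b x)%:E + l%:E * \int[mu]_(x in D) (c x)%:E)%E.
Proof.
move=> mD ma mb mc a0 b0 c0 k0 l0 abc.
have mE (h : T -> R) : measurable_fun D h -> measurable_fun D (fun x => (h x)%:E).
  by move=> mh; apply/measurable_EFinP.
rewrite -(ge0_integralZl mu mD (mE _ mb))// -(ge0_integralZl mu mD (mE _ mc))//.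
rewrite -ge0_integralD//.
- apply: ge0_le_integral => //; try exact: mE.
  by apply: mE; apply: measurable_funD; apply: measurable_funM.
- by move=> x Dx; rewrite -EFinM lee_fin mulr_ge0 ?b0.
- by apply: mE; apply: measurable_funM.
- by move=> x Dx; rewrite -EFinM lee_fin mulr_ge0 ?c0.
- by apply: mE; apply: measurable_funM.
Qed.

Lemma continuous_sum_fun (R : realType) (T : topologicalType) (I : Type) (r : seq I) (F : I -> T -> R) :
  (forall i, continuous (F i)) -> continuous (fun x => \sum_(i <- r) F i x).
Proof.
move=> cF; elim: r => [|i r IH].
  by under [X in continuous X]funext do rewrite big_nil; exact: cst_continuous.
under [X in continuous X]funext do rewrite big_cons.
by move=> x; apply: continuousD; [exact: cF|exact: IH].
Qed.

Section hardy.
Variables (R : realType) (n : nat) (Omega : set 'rV[R]_n).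
Hypothesis oOmega : open Omega.
Implicit Types (f u W : 'rV[R]_n -> R).

Let mOmega : measurable Omega. Proof. exact: open_measurable_rV. Qed.

Lemma sqnorm_grad f x : sqnorm (grad f x) = \sum_i partial i f x ^+ 2.
Proof. by apply: eq_bigr => i _; rewrite mxE. Qed.

(** The difference of the two integrands plus the divergence of [f^2 V], which
    integrates to zero, is at least [|grad f + f V|^2]. *)
Lemma test_hardy_vector_field f (V : 'I_n -> 'rV[R]_n -> R) W :
  test_function Omega f -> (forall j, smooth (V j)) -> continuous W ->
  (forall x, Omega x -> W x <= \sum_j partial j (V j) x - \sum_j V j x ^+ 2) ->
  (\int[leb]_(x in Omega) (W x * f x ^+ 2)%:E <=
   \int[leb]_(x in Omega) (sqnorm (grad f x))%:E)%E.
Proof.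
move=> tf sV cW WV; have [sf cf _] := tf.
have tD j : test_function Omega (f * (f * V j)).
  by apply: test_functionM => //; exact: smoothM.
pose D x := \sum_j partial j (f * (f * V j)) x.
have f0 := @tsupport0 _ _ f.
have sfV j : smooth (f * V j) by exact: smoothM.
have fVE j x : (f * V j) x = f x * V j x by [].
have DE x : D x = \sum_j (f x ^+ 2 * partial j (V j) x + 2 * f x * V j x * partial j f x).
  apply: eq_bigr => j _; rewrite partialM// partialM//.
  by rewrite fVE; ring.
have iDj j : leb.-integrable Omega (EFin \o partial j (f * (f * V j))).
  apply: (compact_support_integrable mOmega cf).
    by apply: smooth_continuous; apply: smooth_partial; exact: smoothM.
  move=> x nf; rewrite partialM// partialM//.
  by rewrite fVE f0// (@partial_tsupport0 _ _ f)//; ring.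
have D0 : (\int[leb]_(x in Omega) (D x)%:E = 0)%E.
  under eq_integral do rewrite /D -sumEFin.
  rewrite integral_sum//; apply: big1 => j _.
  exact: test_integral_partial0.
have iD : leb.-integrable Omega (EFin \o D).
  rewrite (_ : EFin \o D = fun x => (\sum_j (partial j (f * (f * V j)) x)%:E)%E).
    by apply: integrable_sum => // j _; exact: iDj.
  by apply/funext => x /=; rewrite sumEFin.
have ig : leb.-integrable Omega (EFin \o (fun x => sqnorm (grad f x))).
  apply: (compact_support_integrable mOmega cf) => [|x nf].
    under [X in continuous X]funext do rewrite sqnorm_grad.
    apply: continuous_sum_fun => i x.
    by apply: continuousM; apply: smooth_continuous; exact: smooth_partial.
  by rewrite sqnorm_grad big1// => i _; rewrite partial_tsupport0// expr0n.
rewrite -[leRHS]adde0 -D0 -integralD//.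
apply: le_integral => //.
- apply: (compact_support_integrable mOmega cf) => [x|x nf]; last first.
    by rewrite f0// expr0n mulr0.
  apply: (@continuousM _ _ W (f * f) x); first exact: cW.
  by apply: continuousM; apply: smooth_continuous.
- exact: integrableD.
- move=> x; rewrite inE => Ox; rewrite lee_fin.
  apply: (@le_trans _ _ ((\sum_j partial j (V j) x - \sum_j V j x ^+ 2) * f x ^+ 2)).
    by rewrite ler_wpM2r ?sqr_ge0// WV.
  rewrite -subr_ge0 sqnorm_grad DE -sumrB mulr_suml -big_split -sumrB /=.
  apply: sumr_ge0 => j _.
  rewrite (_ : _ - _ = (partial j f x + f x * V j x) ^+ 2) ?sqr_ge0//; ring.
Qed.

(** Both sides are continuous for the [H^1] norm when the weight is bounded.
    The passage to the limit uses
    [a^2 <= (1 + t) b^2 + (1 + 1/t) (a - b)^2] on each side instead of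
    Minkowski's inequality, letting first the error and then [t] tend to 0. *)
Lemma H10_hardy_bounded W K u g : measurable_fun Omega W ->
  (forall x, Omega x -> 0 <= W x <= K) ->
  (forall f, test_function Omega f ->
    (\int[leb]_(x in Omega) (W x * f x ^+ 2)%:E <=
     \int[leb]_(x in Omega) (sqnorm (grad f x))%:E)%E) ->
  H10 Omega u g ->
  (\int[leb]_(x in Omega) (W x * u x ^+ 2)%:E <=
   \int[leb]_(x in Omega) (sqnorm (g x))%:E)%E.
Proof.
move=> mW W0K HW [[[mu u2] gL2 _] apx].
have mg i : measurable_fun Omega (fun x => g x ord0 i) by have [] := gL2 i.
have msq (h : 'rV[R]_n -> 'rV[R]_n) :
    (forall i, measurable_fun Omega (fun x => h x ord0 i)) ->
    measurable_fun Omega (fun x => sqnorm (h x)).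
  move=> mh; apply: measurable_sum => i; exact: measurable_funX.
have W0 x : Omega x -> 0 <= W x by move=> /W0K /andP[].
have WK x : Omega x -> W x <= K by move=> /W0K /andP[].
have [G0|] := eqVneq (\int[leb]_(x in Omega) (sqnorm (g x))%:E)%E +oo%E.
  by rewrite G0 leey.
set G := (X in X != _) => Goo.
have Gge0 : (0 <= G)%E by apply: integral_ge0 => x _; rewrite lee_fin sqnorm_ge0.
have [r r0 Gr] : exists2 r, 0 <= r & G = r%:E.
  move: Goo Gge0; case: G => [r| |]// _; rewrite lee_fin => r0; by exists r.
rewrite -/G Gr.
pose X := (\int[leb]_(x in Omega) (W x * u x ^+ 2)%:E)%E.
(* f approximates u up to the error e; t is the parameter of the Young
   inequality *)
have key t e : 0 < t -> 0 < e ->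
    (X <= ((1 + t) ^+ 2 * r + ((1 + t) * (1 + t^-1) + (1 + t^-1) * `|K|) * e)%:E)%E.
  move=> t0 e0; have [f [tf]] := apx e e0.
  have [sf cf _] := tf.
  have mf : measurable_fun Omega f.
    by apply: measurable_funTS; apply: continuous_measurable_rV; exact: smooth_continuous.
  have mdf i : measurable_fun Omega (partial i f).
    apply: measurable_funTS; apply: continuous_measurable_rV; apply: smooth_continuous.
    exact: smooth_partial.
  have mgf i : measurable_fun Omega (fun x => (g x - grad f x) ord0 i).
    rewrite (_ : (fun _ => _) = (fun x => g x ord0 i) \- partial i f).
      exact: measurable_funB.
    by apply/funext => x; rewrite !mxE.
  have mgrad i : measurable_fun Omega (fun x => grad f x ord0 i).
    rewrite (_ : (fun _ => _) = partial i f); first exact: mdf.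
    by apply/funext => x; rewrite mxE.
  rewrite /H1_sqnorm.
  set E1 := integral _ _ _; set E2 := integral _ _ _ => E12.
  have E10 : (0 <= E1)%E by apply: integral_ge0 => x _; rewrite lee_fin sqr_ge0.
  have E20 : (0 <= E2)%E by apply: integral_ge0 => x _; rewrite lee_fin sqnorm_ge0.
  have E1e : (E1 <= e%:E)%E by apply: le_trans (ltW E12); rewrite leeDl.
  have E2e : (E2 <= e%:E)%E by apply: le_trans (ltW E12); rewrite leeDr.
  have c0 : 0 <= 1 + t^-1 by rewrite addr_ge0// invr_ge0 ltW.
  have d0 : 0 <= 1 + t by rewrite addr_ge0// ltW.
  have young (a b : R) : a ^+ 2 <= (1 + t) * b ^+ 2 + (1 + t^-1) * (a - b) ^+ 2.
    rewrite -subr_ge0 (_ : _ - _ = t^-1 * (a - b - t * b) ^+ 2).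
      by rewrite mulr_ge0 ?sqr_ge0// invr_ge0 ltW.
    by field; rewrite gt_eqF.
  have youngn (v w : 'rV[R]_n) : sqnorm v <= (1 + t) * sqnorm w + (1 + t^-1) * sqnorm (v - w).
    rewrite /sqnorm !mulr_sumr -big_split /=; apply: ler_sum => i _.
    by rewrite !mxE; exact: young.
  have step2 : (\int[leb]_(x in Omega) (sqnorm (grad f x))%:E <=
      (1 + t)%:E * r%:E + (1 + t^-1)%:E * e%:E)%E.
    apply: (@le_trans _ _ ((1 + t)%:E * G + (1 + t^-1)%:E * E2)%E); last first.
      by rewrite Gr leeD// lee_wpmul2l// lee_fin.
    apply: ge0_integral_le_lincomb => //; try exact: msq; try by move=> *; exact: sqnorm_ge0.
    move=> x _; have := youngn (grad f x) (g x); congr (_ <= _ + _ * _).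
    by rewrite /sqnorm; apply: eq_bigr => i _; rewrite !mxE; ring.
  have step1 : (X <= (1 + t)%:E * \int[leb]_(x in Omega) (W x * f x ^+ 2)%:E
      + ((1 + t^-1) * `|K|)%:E * E1)%E.
    apply: ge0_integral_le_lincomb => //.
    - by apply: measurable_funM => //; exact: measurable_funX.
    - by apply: measurable_funM => //; exact: measurable_funX.
    - by apply: measurable_funX; exact: measurable_funB.
    - by move=> x Ox; rewrite mulr_ge0 ?sqr_ge0 ?W0.
    - by move=> x Ox; rewrite mulr_ge0 ?sqr_ge0 ?W0.
    - by move=> x Ox; rewrite sqr_ge0.
    - by rewrite mulr_ge0.
    move=> x Ox.
    apply: le_trans (ler_wpM2l (W0 x Ox) (young (u x) (f x))) _.
    rewrite mulrDr lerD//; first by rewrite mulrCA.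
    rewrite mulrA ler_wpM2r ?sqr_ge0// mulrC ler_wpM2l//.
    exact: le_trans (WK x Ox) (ler_norm _).
  apply: (le_trans step1).
  apply: (@le_trans _ _ ((1 + t)%:E * ((1 + t)%:E * r%:E + (1 + t^-1)%:E * e%:E) +
      ((1 + t^-1) * `|K|)%:E * e%:E)%E).
    rewrite leeD// lee_wpmul2l ?lee_fin ?mulr_ge0//.
    exact: le_trans (HW f tf) step2.
  rewrite (_ : (1 + t) ^+ 2 * r + _ =
    (1 + t) * ((1 + t) * r + (1 + t^-1) * e) + (1 + t^-1) * `|K| * e) ?lexx//.
  by ring.
have key2 t : 0 < t -> (X <= ((1 + t) ^+ 2 * r)%:E)%E.
  move=> t0; apply/lee_addgt0Pr => d d0.
  pose c := (1 + t) * (1 + t^-1) + (1 + t^-1) * `|K|.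
  have c0 : 0 < c.
    rewrite ltr_wpDr//; first by rewrite mulr_ge0// addr_ge0// invr_ge0 ltW.
    by rewrite mulr_gt0// addr_gt0// invr_gt0.
  have := key t (d / c) t0 (divr_gt0 d0 c0).
  by rewrite -/c mulrC [c * _]mulrC divfK ?gt_eqF// EFinD mulrC.
apply/lee_addgt0Pr => d d0.
have r1 : 0 < r + 1 by rewrite ltr_wpDl.
pose s := Num.min 1 (d / (r + 1)).
have s0 : 0 < s by rewrite lt_min ltr01 divr_gt0.
have s1 : s <= 1 by rewrite ge_min lexx.
have sd : s * (r + 1) <= d by rewrite -ler_pdivlMr// ge_min lexx orbT.
apply: le_trans (key2 (s / 3) _) _; first by rewrite divr_gt0.
rewrite -EFinD lee_fin; nra.
Qed.

Lemma H10_hardy_nondecreasing (W_ : nat -> 'rV[R]_n -> R) W u (g : 'rV[R]_n -> 'rV[R]_n) :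
  (forall m, measurable_fun Omega (W_ m)) ->
  (forall m x, Omega x -> 0 <= W_ m x) ->
  (forall x, Omega x -> nondecreasing_seq (W_ ^~ x)) ->
  (forall x, Omega x -> W_ ^~ x @ \oo --> W x) ->
  (forall m, (\int[leb]_(x in Omega) (W_ m x * u x ^+ 2)%:E <=
     \int[leb]_(x in Omega) (sqnorm (g x))%:E)%E) ->
  measurable_fun Omega u ->
  (\int[leb]_(x in Omega) (W x * u x ^+ 2)%:E <=
   \int[leb]_(x in Omega) (sqnorm (g x))%:E)%E.
Proof.
move=> mW W0 ndW cW HW mu.
rewrite (@eq_integral _ _ _ _ _ (fun x => limn (fun m => (W_ m x * u x ^+ 2)%:E))); last first.
  move=> x; rewrite inE => Ox; apply/esym/cvg_lim => //.
  apply: cvg_EFin; first by near=> m.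
  by apply: cvgM; [exact: cW|exact: cvg_cst].
rewrite monotone_convergence//.
- apply: lime_le; last by near=> m; exact: HW.
  apply: ereal_nondecreasing_is_cvgn => m p mp; apply: ge0_le_integral => //.
  + by move=> x Ox; rewrite lee_fin mulr_ge0 ?sqr_ge0 ?W0.
  + by apply/measurable_EFinP; apply: measurable_funM => //; exact: measurable_funX.
  + by apply/measurable_EFinP; apply: measurable_funM => //; exact: measurable_funX.
  + by move=> x Ox; rewrite lee_fin ler_wpM2r ?sqr_ge0// ndW.
- by move=> m; apply/measurable_EFinP; apply: measurable_funM => //; exact: measurable_funX.
- by move=> m x Ox; rewrite lee_fin mulr_ge0 ?sqr_ge0 ?W0.
- by move=> x Ox m p mp; rewrite lee_fin ler_wpM2r ?sqr_ge0// ndW.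
Unshelve. all: by end_near.
Qed.
End hardy.

(** * The improved multipolar inequality *)

(** This is [W <= div V - |V|^2] for the mixture [V] of the regularized one-pole
    fields, at one point [x]: here [y i = x - a_i], [q i = |y i|^2],
    [p i = (q i + eta)^-1], [D] bounds the squared distances in the domain and
    [m] bounds below the weighted mean of the squared distances from a pole.
    Replacing [2 (y i . y l)] by [q i + q l - |y i - y l|^2] in [|V|^2] makes the
    improvement appear, and [p l >= 1/D] makes it proportional to [p i]. *)
Lemma multipole_pointwise (R : realType) (N n : nat) (k eta D m : R)
    (mu q p : 'I_n -> R) (y : 'I_n -> 'I_N -> R) :
  0 < eta -> 0 < D -> 0 < k -> k = (N%:R - 2) / 2 ->
  (forall i, 0 < mu i) -> \sum_i mu i = 1 ->
  (forall i, q i = \sum_j y i j ^+ 2) ->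
  (forall i, p i = (q i + eta)^-1) ->
  (forall i, q i + eta <= D) ->
  (forall i, m <= \sum_l mu l * \sum_j (y i j - y l j) ^+ 2) -> 0 <= m ->
  (k ^+ 2 + k ^+ 2 * m / (2 * D)) * (\sum_i mu i * (q i * p i ^+ 2)) <=
  k * (\sum_i mu i * (N%:R * p i - 2 * q i * p i ^+ 2)) -
  \sum_j (k * \sum_i mu i * (y i j * p i)) ^+ 2.
Proof.
move=> eta0 D0 k0 kE mu0 mu1 qE pE qD mv m0.
have q0 i : 0 <= q i by rewrite qE; apply: sumr_ge0 => j _; exact: sqr_ge0.
have qeta i : 0 < q i + eta by rewrite ltr_wpDl.
have p0 i : 0 < p i by rewrite pE invr_gt0.
have [k_ge0 D_ge0 eta_ge0] : [/\ 0 <= k, 0 <= D & 0 <= eta] by split; exact: ltW.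
have mu_ge0 i : 0 <= mu i by exact: ltW.
have p_ge0 i : 0 <= p i by exact: ltW.
have qp i : q i * p i = 1 - eta * p i.
  by apply: (mulIf (lt0r_neq0 (qeta i))); rewrite pE; field; rewrite gt_eqF.
have qpp i : q i * p i ^+ 2 <= p i.
  rewrite expr2 mulrA qp; have := mulr_gt0 (mulr_gt0 eta0 (p0 i)) (p0 i); lra.
have pD i : D^-1 <= p i by rewrite pE lef_pV2 ?posrE// qD.
pose S := \sum_i mu i * p i.
have divV : 2 * k ^+ 2 * S <= k * (\sum_i mu i * (N%:R * p i - 2 * q i * p i ^+ 2)).
  rewrite expr2 mulrA [2 * k * k]mulrC -mulrA ler_wpM2l// /S mulr_sumr.
  apply: ler_sum => i _; rewrite mulrCA ler_wpM2l//.
  have := qpp i; rewrite kE => ?; rewrite -[2 * q i * _]mulrA; lra.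
have WS : (k ^+ 2 + k ^+ 2 * m / (2 * D)) * (\sum_i mu i * (q i * p i ^+ 2)) <=
    (k ^+ 2 + k ^+ 2 * m / (2 * D)) * S.
  rewrite ler_wpM2l//.
    by rewrite addr_ge0 ?sqr_ge0// divr_ge0 ?mulr_ge0 ?sqr_ge0.
  by apply: ler_sum => i _; rewrite ler_wpM2l// qpp.
have V2 : \sum_j (k * \sum_i mu i * (y i j * p i)) ^+ 2 <=
    (k ^+ 2 - k ^+ 2 * m / (2 * D)) * S.
  have -> : \sum_j (k * \sum_i mu i * (y i j * p i)) ^+ 2 =
     k ^+ 2 * \sum_i \sum_l mu i * mu l * ((p i + p l) / 2 - eta * (p i * p l)
         - (\sum_j (y i j - y l j) ^+ 2) * (p i * p l) / 2).
    under eq_bigr do rewrite exprMn [X in _ * X]expr2 big_distrlr /=.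
    rewrite -mulr_sumr exchange_big /=; congr (_ * _); apply: eq_bigr => i _.
    rewrite exchange_big /=; apply: eq_bigr => l _.
    have -> : \sum_j (y i j - y l j) ^+ 2 = q i + q l - 2 * \sum_j y i j * y l j.
      rewrite !qE mulr_sumr -big_split -sumrB; apply: eq_bigr => j _ /=; ring.
    rewrite (_ : \sum_j _ = mu i * mu l * (p i * p l * \sum_j y i j * y l j)).
      congr (_ * _).
      have -> : (p i + p l) / 2 - eta * (p i * p l) =
         (p l * (1 - eta * p i) + p i * (1 - eta * p l)) / 2 by field.
      by rewrite -!qp; field.
    by rewrite !mulr_sumr; apply: eq_bigr => j _; ring.
  rewrite (_ : (_ - _) * S = k ^+ 2 * (S - m / (2 * D) * S)); last by field; rewrite gt_eqF.
  rewrite ler_wpM2l ?sqr_ge0//.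
  apply: (@le_trans _ _ (\sum_i \sum_l (mu i * mu l * ((p i + p l) / 2)
     - mu i * p i / (2 * D) * (mu l * \sum_j (y i j - y l j) ^+ 2)))).
    apply: ler_sum => i _; apply: ler_sum => l _.
    set d := \sum_j _; have d0 : 0 <= d by apply: sumr_ge0 => j _; exact: sqr_ge0.
    rewrite (_ : _ - _ * (_ * d) =
      mu i * mu l * ((p i + p l) / 2 - d * (p i * D^-1) / 2)); last first.
      by field; rewrite gt_eqF.
    rewrite ler_wpM2l ?mulr_ge0//.
    have h : 0 <= eta * (p i * p l) by rewrite !mulr_ge0.
    have h2 : d * (p i * D^-1) <= d * (p i * p l).
      by rewrite ler_wpM2l// ler_wpM2l// pD.
    lra.
  under eq_bigr do rewrite sumrB -mulr_sumr.
  rewrite sumrB; apply: lerB.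
    rewrite le_eqVlt; apply/orP; left; apply/eqP.
    have -> : \sum_i \sum_l mu i * mu l * ((p i + p l) / 2) =
      \sum_i \sum_l mu i * mu l * (p i / 2) + \sum_i \sum_l mu i * mu l * (p l / 2).
      rewrite -big_split; apply: eq_bigr => i _; rewrite -big_split /=.
      by apply: eq_bigr => l _; field.
    rewrite [X in _ + X]exchange_big /=.
    have -> : \sum_i \sum_l mu i * mu l * (p i / 2) = S / 2.
      rewrite mulr_suml; apply: eq_bigr => i _.
      transitivity (\sum_l mu l * (mu i * p i / 2)); first by apply: eq_bigr => l _; field.
      by rewrite -mulr_suml mu1 mul1r.
    have -> : \sum_(j < n) \sum_(i < n) mu i * mu j * (p j / 2) = S / 2.
      rewrite mulr_suml; apply: eq_bigr => i _.
      transitivity (\sum_l mu l * (mu i * p i / 2)); first by apply: eq_bigr => l _; field.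
      by rewrite -mulr_suml mu1 mul1r.
    by field.
  rewrite mulr_sumr; apply: ler_sum => i _.
  rewrite (_ : m / (2 * D) * _ = mu i * p i / (2 * D) * m); last by field; rewrite gt_eqF.
  by rewrite ler_wpM2l// divr_ge0// ?mulr_ge0.
rewrite lerBrDr; apply: le_trans (lerD WS V2) _; apply: le_trans divV.
by rewrite -mulrDl ler_wpM2r//; [apply: sumr_ge0 => i _; rewrite mulr_ge0|lra].
Qed.

Lemma inv_smooth_sqnorm (R : realType) (n : nat) (a : 'rV[R]_n) (eta : R) : 0 < eta ->
  smooth (fun x => (sqnorm (x - a) + eta)^-1).
Proof.
move=> eta0; rewrite (_ : (fun _ => _) = (fun x => (sqnorm (x - a) + eta) `^ (-1))).
  exact: smooth_powR_sqnorm.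
by apply/funext => x; rewrite powR_inv1// addr_ge0 ?sqnorm_ge0// ltW.
Qed.

Lemma is_derive_inv_sqnorm (R : realType) (n : nat) (a : 'rV[R]_n) (eta : R)
    (x : 'rV[R]_n) j : 0 < eta ->
  is_derive x (delta_mx ord0 j) (fun x => (sqnorm (x - a) + eta)^-1)
   (- 2 * (x ord0 j - a ord0 j) * (sqnorm (x - a) + eta)^-1 ^+ 2).
Proof.
move=> eta0; rewrite (_ : (fun _ => _) = (fun x => (sqnorm (x - a) + eta) `^ (-1))); last first.
  by apply/funext => z; rewrite powR_inv1// addr_ge0 ?sqnorm_ge0// ltW.
apply: (is_derive_eq (is_derive_powR_sqnorm a (-1) x j eta0)).
rewrite -opprD -natr1 -[1 + _]/(2%:R) powRN powR_mulrn ?exprVn; last first.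
  by rewrite addr_ge0 ?sqnorm_ge0// ltW.
by rewrite -exprVn; ring.
Qed.

Lemma measurable_sqnorm_weight (R : realType) (n : nat) (Omega : set 'rV[R]_n)
    (u : 'rV[R]_n -> R) (b : 'rV[R]_n) :
  measurable_fun Omega u -> measurable_fun Omega (fun x => u x ^+ 2 / sqnorm (x - b)).
Proof.
move=> mu; apply: measurable_funM; first exact: measurable_funX.
rewrite (_ : (fun _ => _) = (fun x => sqnorm (x - b) `^ (-1))); last first.
  by apply/funext => x; rewrite powR_inv1 ?sqnorm_ge0.
apply: (@measurableT_comp _ _ _ _ _ _ (@powR R ^~ (-1))) => //; apply: measurable_funTS.
by apply: continuous_measurable_rV; apply: smooth_continuous; exact: smooth_sqnorm.
Qed.

(** The weight [1/q] is approximated by [q / (q + eta)^2] rather than by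
    [1 / (q + eta)]: the former vanishes at the pole, as [q^-1] does for
    [q = 0], so that the monotone convergence holds at every point. *)
Lemma regularized_weight_nonincreasing (R : realType) (q s t : R) :
  0 <= q -> 0 < s -> s <= t -> q * (q + t)^-1 ^+ 2 <= q * (q + s)^-1 ^+ 2.
Proof.
move=> q0 s0 st; rewrite ler_wpM2l// !exprVn lef_pV2 ?posrE ?exprn_gt0//.
- by rewrite lerXn2r ?nnegrE ?lerD2l// addr_ge0// ltW// (lt_le_trans s0).
- by rewrite ltr_wpDl// (lt_le_trans s0).
- by rewrite ltr_wpDl.
Qed.

Lemma cvg_sum_fun (R : realType) (I : Type) (r : seq I) (F : I -> nat -> R) (l : I -> R) :
  (forall i, F i m @[m --> \oo] --> l i) ->
  \sum_(i <- r) F i m @[m --> \oo] --> \sum_(i <- r) l i.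
Proof.
move=> Fl; elim: r => [|i r IH].
  by rewrite big_nil; under eq_fun do rewrite big_nil; exact: cvg_cst.
rewrite big_cons; under eq_fun do rewrite big_cons.
by apply: cvgD; [exact: Fl|exact: IH].
Qed.

Lemma regularized_weight_cvg (R : realType) (q : R) : 0 <= q ->
  (q * (q + m.+1%:R^-1)^-1 ^+ 2) @[m --> \oo] --> q^-1.
Proof.
rewrite le_eqVlt => /predU1P[<-|q0].
  by under eq_fun do rewrite mul0r; rewrite invr0; exact: cvg_cst.
rewrite (_ : q^-1 = q * (q + 0)^-1 ^+ 2); last by rewrite addr0; field; rewrite gt_eqF.
apply: cvgM; first exact: cvg_cst.
have cI : (q + m.+1%:R^-1)^-1 @[m --> \oo] --> (q + 0)^-1.
  apply: cvgV; first by rewrite addr0 gt_eqF.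
  by apply: cvgD; [exact: cvg_cst|exact: cvg_harmonic].
exact: (cvgM cI cI).
Qed.

Lemma common_pos_lower_bound (R : realType) (n : nat) (v : 'I_n -> R) :
  (forall i, 0 < v i) -> exists2 m, 0 < m & forall i, m <= v i.
Proof.
move=> v0; pose s := 1 + \sum_i (v i)^-1.
have vi i : 0 <= (v i)^-1 by rewrite invr_ge0 ltW.
have s0 : 0 < s by rewrite ltr_wpDr// sumr_ge0.
exists s^-1 => [|i]; first by rewrite invr_gt0.
rewrite -[v i]invrK lef_pV2 ?posrE ?invr_gt0// /s (bigD1 i)//=.
by rewrite addrCA lerDl addr_ge0// sumr_ge0.
Qed.

Lemma sqnorm_gt0 (R : realType) (n : nat) (x : 'rV[R]_n) : x != 0 -> 0 < sqnorm x.
Proof.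
move=> x0; rewrite lt_neqAle sqnorm_ge0 andbT eq_sym; apply: contra x0 => /eqP.
move=> /psumr_eq0P h; apply/eqP/rowP => i; rewrite mxE.
by apply/eqP; rewrite -sqrf_eq0; apply/eqP; apply: h => // j _; exact: sqr_ge0.
Qed.

Lemma bounded_sqnorm (R : realType) (n : nat) (Omega : set 'rV[R]_n) :
  bounded_set Omega -> exists D, forall x y, Omega x -> Omega y -> sqnorm (x - y) <= D.
Proof.
move=> /bounded_coord[M OM]; exists (\sum_(i < n) (M + M) ^+ 2) => x y Ox Oy.
rewrite sqnormE; apply: ler_sum => j _.
have := OM x Ox j; have := OM y Oy j; rewrite !ler_norml => /andP[? ?] /andP[? ?].
by rewrite -[leLHS]real_normK ?num_real// lerXn2r ?nnegrE// ?ler_norml; lra.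
Qed.

(** The pointwise inequality makes [test_hardy_vector_field] applicable to the
    regularized weights, with the same constant for all [eta <= 1]; density and
    monotone convergence do the rest. The improvement depends on the domain
    through its diameter, and on the poles through their mutual distances. *)
Lemma multipole_hardy_improved (R : realType) (N n : nat) (Omega : set 'rV[R]_N)
    (a : 'I_n -> 'rV[R]_N) (gamma : 'I_n -> R) :
  (3 <= N)%N -> (2 <= n)%N -> open Omega -> bounded_set Omega ->
  injective a -> (forall i, Omega (a i)) -> (forall i, 0 < gamma i) ->
  exists2 C, hardy_inequality Omega a gamma C &
    (N%:R - 2) ^+ 2 / 4 < C * \sum_i gamma i.
Proof.
move=> N3 n2 oO bO a_inj aO g0.
have mO : measurable Omega by exact: open_measurable_rV.
pose k : R := (N%:R - 2) / 2.
have k0 : 0 < k by rewrite divr_gt0// subr_gt0 ltr_nat.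
have [D0 HD0] := bounded_sqnorm bO.
(* the summand 1 leaves room for eta <= 1 in q i + eta <= D *)
pose D : R := `|D0| + 1.
have DD x i : Omega x -> sqnorm (x - a i) + 1 <= D.
  by move=> Ox; rewrite lerD2r (le_trans (HD0 _ _ Ox (aO i)))// ler_norm.
have D_gt0 : 0 < D by rewrite ltr_wpDl.
pose Gam := \sum_i gamma i.
have Gam0 : 0 < Gam.
  rewrite /Gam (bigD1 (Ordinal (ltnW n2)))//= ltr_wpDr// sumr_ge0// => i _.
  exact: ltW.
pose mu i := gamma i / Gam.
have mu0 i : 0 < mu i by rewrite divr_gt0.
have mu1 : \sum_i mu i = 1 by rewrite -mulr_suml divff// gt_eqF.
have [m m0 mv] : exists2 m, 0 < m &
    forall i, m <= \sum_l mu l * sqnorm (a l - a i).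
  apply: common_pos_lower_bound => i.
  (* a second pole makes the mean squared distance positive *)
  have [l li] : exists l : 'I_n, l != i.
    have [i0|i0] := eqVneq (val i) 0%N.
      by exists (Ordinal n2); rewrite -val_eqE /= i0.
    by exists (Ordinal (ltnW n2)); rewrite -val_eqE /= eq_sym.
  rewrite (bigD1 l)//= ltr_pwDl//; last first.
    by apply: sumr_ge0 => j _; rewrite mulr_ge0 ?sqnorm_ge0// ltW.
  rewrite mulr_gt0// sqnorm_gt0// subr_eq0; apply: contra li => /eqP /a_inj ->//.
(* k ^+ 2 is the one-pole constant, the other term is the gain *)
pose c := k ^+ 2 + k ^+ 2 * m / (2 * D).
have k20 : 0 < k ^+ 2 by rewrite exprn_gt0.
have ck : 0 < k ^+ 2 * m / (2 * D) by rewrite divr_gt0// mulr_gt0.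
have c0 : 0 < c by rewrite addr_gt0.
have c_ge0 := ltW c0; have mu_ge0 i : 0 <= mu i by exact: ltW.
exists (c / Gam); last first.
  rewrite divfK ?gt_eqF// /c (_ : _ / 4 = k ^+ 2); last by rewrite /k; field.
  by rewrite ltrDl.
pose Wi eta i x := mu i * (sqnorm (x - a i) * (sqnorm (x - a i) + eta)^-1 ^+ 2).
pose W eta x := c * \sum_i Wi eta i x.
have sWi eta i : 0 < eta -> smooth (Wi eta i).
  move=> eta0; apply: (@smoothM _ _ (cst (mu i))); first exact: smooth_cst.
  apply: (@smoothM _ _ (fun x => sqnorm (x - a i))); first exact: smooth_sqnorm.
  by apply: (@smoothM _ _ (fun x => (sqnorm (x - a i) + eta)^-1)); exact: inv_smooth_sqnorm.
have sW eta : 0 < eta -> smooth (W eta).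
  move=> eta0; apply: (@smoothM _ _ (cst c)); first exact: smooth_cst.
  by apply: smooth_sum => i; exact: sWi.
have W0 eta x : 0 <= W eta x.
  rewrite mulr_ge0//; apply: sumr_ge0 => i _.
  by rewrite mulr_ge0// mulr_ge0 ?sqnorm_ge0// sqr_ge0.
have test_hardy eta f : 0 < eta -> eta <= 1 -> test_function Omega f ->
    (\int[leb]_(x in Omega) (W eta x * f x ^+ 2)%:E <=
     \int[leb]_(x in Omega) (sqnorm (grad f x))%:E)%E.
  move=> eta0 eta1 tf.
  pose V j (x : 'rV[R]_N) := k * \sum_i mu i * ((x ord0 j - a i ord0 j) * (sqnorm (x - a i) + eta)^-1).
  have sV j : smooth (V j).
    apply: (@smoothM _ _ (cst k)); first exact: smooth_cst.
    apply: smooth_sum => i; apply: (@smoothM _ _ (cst (mu i))); first exact: smooth_cst.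
    apply: (@smoothM _ _ (fun x : 'rV[R]_N => x ord0 j - a i ord0 j)).
      exact: smooth_shift_coord.
    exact: inv_smooth_sqnorm.
  have dV j x : partial j (V j) x = k * \sum_i mu i * ((sqnorm (x - a i) + eta)^-1
      - 2 * (x ord0 j - a i ord0 j) ^+ 2 * (sqnorm (x - a i) + eta)^-1 ^+ 2).
    apply: partial_val.
    have D1 i : is_derive x (delta_mx ord0 j)
       (fun x : 'rV[R]_N => mu i * ((x ord0 j - a i ord0 j) * (sqnorm (x - a i) + eta)^-1))
       (mu i * ((sqnorm (x - a i) + eta)^-1
      - 2 * (x ord0 j - a i ord0 j) ^+ 2 * (sqnorm (x - a i) + eta)^-1 ^+ 2)).
      have H1 := is_deriveM (is_derive_shift_coord (a i) j x (delta_mx ord0 j))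
        (is_derive_inv_sqnorm (a i) x j eta0).
      apply: (is_derive_eq (is_deriveM (is_derive_cst (mu i) x (delta_mx ord0 j)) H1)).
      rewrite scaler0 addr0 /GRing.scale /= !mxE !eqxx /=; ring.
    have H2 := is_derive_sum_fun (index_enum 'I_n) D1.
    apply: (is_derive_eq (is_deriveM (is_derive_cst k x (delta_mx ord0 j)) H2)).
    by rewrite scaler0 addr0.
  apply: (@test_hardy_vector_field _ _ _ oO f V) => //.
    exact/smooth_continuous/sW.
  move=> x Ox.
  have -> : \sum_j partial j (V j) x = k * (\sum_i mu i * (N%:R * (sqnorm (x - a i) + eta)^-1
       - 2 * sqnorm (x - a i) * (sqnorm (x - a i) + eta)^-1 ^+ 2)).
    under eq_bigr do rewrite dV.
    rewrite -mulr_sumr exchange_big /=; congr (_ * _); apply: eq_bigr => i _.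
    rewrite -mulr_sumr; congr (_ * _); rewrite sumrB sumr_const card_ord.
    by rewrite mulr_natl -!mulr_suml -mulr_sumr -sqnormE.
  apply: (@multipole_pointwise R N n k eta D m mu _ _
     (fun i j => x ord0 j - a i ord0 j)) => //.
  - by move=> i; exact: sqnormE.
  - by move=> i; apply: le_trans (DD x i Ox); rewrite lerD2l.
  - move=> i; apply: le_trans (mv i) _; rewrite le_eqVlt; apply/orP; left; apply/eqP.
    apply: eq_bigr => l _; congr (_ * _); rewrite sqnormE; apply: eq_bigr => j _; ring.
  - exact: ltW.
move=> u g ug; have [[[mu_ _] _ _] _] := ug.
pose eta_ p : R := p.+1%:R^-1.
have eta0 p : 0 < eta_ p by rewrite invr_gt0.
have eta1 p : eta_ p <= 1 by rewrite invf_le1 ?ler1n.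
have mW p : measurable_fun Omega (W (eta_ p)).
  by apply: measurable_funTS; apply: continuous_measurable_rV; exact/smooth_continuous/sW.
pose Winf x := c * \sum_i mu i * (sqnorm (x - a i))^-1.
have cW x : W (eta_ p) x @[p --> \oo] --> Winf x.
  apply: cvgM; first exact: cvg_cst.
  apply: cvg_sum_fun => i; apply: cvgM; first exact: cvg_cst.
  exact/regularized_weight_cvg/sqnorm_ge0.
have Whardy p : (\int[leb]_(x in Omega) (W (eta_ p) x * u x ^+ 2)%:E <=
     \int[leb]_(x in Omega) (sqnorm (g x))%:E)%E.
  apply: (@H10_hardy_bounded _ _ _ oO _ (c * \sum_i mu i * (eta_ p)^-1)) => //.
    move=> x Ox; rewrite W0 /=; rewrite ler_wpM2l//; apply: ler_sum => i _.
    rewrite ler_wpM2l//.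
    have q0 := sqnorm_ge0 (x - a i); set q := sqnorm _ in q0 *.
    have qe : 0 < q + eta_ p by rewrite ltr_wpDl.
    rewrite expr2 mulrA (@le_trans _ _ (1 * (q + eta_ p)^-1))//.
      by rewrite ler_wpM2r ?invr_ge0 ?(ltW qe)// ler_pdivrMr// mul1r lerDl ltW.
    by rewrite mul1r lef_pV2 ?posrE// lerDr.
  by move=> f tf; exact: test_hardy.
have := @H10_hardy_nondecreasing _ _ _ oO (fun p => W (eta_ p)) Winf u g.
move=> /(_ mW (fun p x _ => W0 _ x)) /(_ _ (fun x _ => cW x) Whardy mu_).
have nd x : Omega x -> nondecreasing_seq (fun p => W (eta_ p) x).
  move=> Ox p r pr; rewrite ler_wpM2l//; apply: ler_sum => i _.
  rewrite ler_wpM2l//; apply: regularized_weight_nonincreasing => //.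
    exact: sqnorm_ge0.
  by rewrite lef_pV2 ?posrE// ler_nat ltnS.
move=> /(_ nd); apply: le_trans; rewrite le_eqVlt; apply/orP; left; apply/eqP.
have mi i : measurable_fun Omega (fun x => gamma i * (`|u x| ^+ 2 / sqnorm (x - a i))).
  apply: measurable_funM => //.
  apply: (@measurable_sqnorm_weight _ _ _ (fun x => `|u x|)).
  exact: measurableT_comp.
rewrite -ge0_integral_sum//; last 2 first.
- by move=> i; apply/measurable_EFinP.
- move=> i x _; rewrite lee_fin mulr_ge0 ?(ltW (g0 i))// mulr_ge0 ?sqr_ge0// invr_ge0.
  exact: sqnorm_ge0.
rewrite -ge0_integralZl//; last 3 first.
- under [X in measurable_fun _ X]funext do rewrite sumEFin.
  by apply/measurable_EFinP; apply: measurable_sum.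
- move=> x _; apply: sume_ge0 => i _; rewrite lee_fin mulr_ge0 ?(ltW (g0 i))//.
  by rewrite mulr_ge0 ?sqr_ge0// invr_ge0 sqnorm_ge0.
- by rewrite lee_fin divr_ge0// ltW.
apply: eq_integral => x _.
rewrite sumEFin -EFinM; congr EFin; rewrite /Winf.
rewrite !mulr_sumr mulr_suml; apply: eq_bigr => i _.
by rewrite real_normK ?num_real// /mu; ring.
Qed.

(** * The flat exponential *)

(** The family [t^-m exp (- 1/t)], extended by 0, is stable under derivatives;
    its member [m = 0] is the usual smooth cutoff. *)
Definition flat_exp (R : realType) (m : nat) (t : R) : R :=
  if 0 < t then t^-1 ^+ m * expR (- t^-1) else 0.

Section flat_exp.
Variable R : realType.
Implicit Types (t : R) (m : nat).

Lemma flat_exp_ge0 m t : 0 <= flat_exp m t.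
Proof.
rewrite /flat_exp; case: ifPn => // t0.
by rewrite mulr_ge0 ?expR_ge0// exprn_ge0// invr_ge0 ltW.
Qed.

Lemma flat_exp0 m t : t <= 0 -> flat_exp m t = 0.
Proof. by rewrite /flat_exp leNgt => /negbTE ->. Qed.

Lemma expRN_le m t : 0 < t -> expR (- t^-1) <= m.+1`!%:R * t ^+ m.+1.
Proof.
move=> t0; have pos : 0 < m.+1`!%:R * t ^+ m.+1 by rewrite mulr_gt0 ?exprn_gt0// ltr0n fact_gt0.
rewrite expRN -[leRHS]invrK lef_pV2 ?posrE ?invr_gt0 ?expR_gt0//.
have ti : 0 <= t^-1 by rewrite invr_ge0 ltW.
apply: le_trans (expR_ge1Dxn m ti).
by rewrite invfM mulrC exprVn lerDr.
Qed.

(** The quadratic bound at 0 gives the derivative there. *)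
Lemma flat_exp_le m t : flat_exp m t <= (m.+2)`!%:R * t ^+ 2.
Proof.
have [t0|t0] := leP t 0; first by rewrite flat_exp0// mulr_ge0 ?sqr_ge0.
rewrite /flat_exp t0.
apply: le_trans (ler_wpM2l _ (@expRN_le m.+1 t t0)) _.
  by rewrite exprn_ge0// invr_ge0 ltW.
rewrite mulrCA ler_wpM2l// -addn2 exprD mulrA -exprMn mulVf ?gt_eqF//.
by rewrite expr1n mul1r.
Qed.

Lemma flat_exp2_le t : flat_exp 2 t <= 2.
Proof.
have [t0|t0] := leP t 0; first by rewrite flat_exp0.
rewrite /flat_exp t0.
apply: le_trans (ler_wpM2l _ (@expRN_le 1 t t0)) _.
  by rewrite exprn_ge0// invr_ge0 ltW.
by rewrite mulrCA -exprMn mulVf ?gt_eqF// expr1n mulr1.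
Qed.

Lemma flat_exp_lower m s t : 0 < s -> s <= t -> expR (- s^-1) <= flat_exp 0 t.
Proof.
move=> s0 st; have t0 := lt_le_trans s0 st.
by rewrite /flat_exp t0 expr0 mul1r ler_expR lerN2 lef_pV2.
Qed.

Lemma is_derive_flat_exp m t :
  is_derive t 1 (@flat_exp R m) (- m%:R * flat_exp m.+1 t + 1 * flat_exp m.+2 t).
Proof.
have [t0|t0|->] := ltgtP t 0.
- rewrite !flat_exp0 ?ltW// !mulr0 addr0.
  apply: (near_eq_is_derive _ (is_derive_cst 0 t 1)).
  by near=> s; rewrite flat_exp0// ltW//; near: s; exact: lt_nbhsl.
- have iD : is_derive t 1 (fun s : R => s^-1) (- t ^- 2).
    have dV : differentiable (GRing.inv : R -> R) t.
      by apply: differentiable_Rinv; rewrite gt_eqF.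
    split; first exact: diff_derivable.
    by rewrite deriveE// diff_Rinv ?gt_eqF// [LHS]mulr1.
  have eD := is_derive1_comp (is_derive_expR _) (is_deriveN iD).
  have H := is_deriveM (is_deriveX m iD) eD.
  apply: (near_eq_is_derive _ (is_derive_eq H _)).
    near=> s; have s0 : 0 < s by near: s; exact: lt_nbhsr.
    by rewrite /flat_exp s0 exprfctE.
  rewrite /flat_exp t0 exprfctE opprfctE /GRing.scale /=.
  case: m {H} => [|m] /=; first by field; rewrite gt_eqF.
  by rewrite !exprS; field; rewrite gt_eqF.
- rewrite !flat_exp0// !mulr0 addr0.
  have lim0 : h^-1 *: (flat_exp m (h *: 1 + 0) - flat_exp m 0) @[h --> (0:R)^'] --> (0 : R).
    apply: (@cvg_to_0_linear _ _ (m.+2)`!%:R 1) => // r /andP[r0 _].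
    rewrite [r *: 1]mulr1 addr0 (@flat_exp0 m 0)// subr0 [_ *: _]mulrC.
    rewrite normrM normfV ler_pdivrMr// -mulrA -expr2 real_normK ?num_real//.
    by rewrite ger0_norm ?flat_exp_ge0// flat_exp_le.
  by split; [apply/cvg_ex; exists 0|exact: cvg_lim lim0].
Unshelve. all: by end_near.
Qed.
End flat_exp.

(** * Test functions concentrating at a pole *)

Section pole_profile.
Variables (R : realType) (N : nat) (a : 'rV[R]_N) (k rho : R).
Hypotheses (k0 : 0 < k) (rho0 : 0 < rho).

(** A regularized and localized version of [|x - a|^(-k)], the virtual extremal
    of the one-pole Hardy inequality. *)
Definition pole_profile (eta : R) (x : 'rV[R]_N) : R :=
  (sqnorm (x - a) + eta) `^ (- (k / 2)) * flat_exp 0 (rho ^+ 2 - sqnorm (x - a)).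

Let cutoff_arg := cst (rho ^+ 2) + cst (-1) * (fun x : 'rV[R]_N => sqnorm (x - a)).

Let cutoff_argE x : cutoff_arg x = rho ^+ 2 - sqnorm (x - a).
Proof. by rewrite /cutoff_arg /= -[(_ + _) x]/(_ + -1 * _) mulN1r. Qed.

Let smooth_cutoff_arg : smooth cutoff_arg.
Proof.
by apply: smoothD; [|apply: smoothM]; [exact: smooth_cst..|exact: smooth_sqnorm].
Qed.

Let smooth_cutoff : smooth (fun x : 'rV[R]_N => flat_exp 0 (rho ^+ 2 - sqnorm (x - a))).
Proof.
rewrite (_ : (fun _ => _) = @flat_exp R 0 \o cutoff_arg); last first.
  by apply/funext => x /=; rewrite cutoff_argE.
apply: (@smooth_comp _ _ _ [set h | exists m, h = @flat_exp R m]) => //; last by exists 0%N.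
move=> _ [m ->]; exists (- m%:R), 1, (@flat_exp R m.+1), (@flat_exp R m.+2).
split; [by exists m.+1|by exists m.+2|move=> x; exact: is_derive_flat_exp].
Qed.

Let is_derive_cutoff x j : is_derive x (delta_mx ord0 j)
  (fun x : 'rV[R]_N => flat_exp 0 (rho ^+ 2 - sqnorm (x - a)))
  (flat_exp 2 (rho ^+ 2 - sqnorm (x - a)) * (- 2 * (x ord0 j - a ord0 j))).
Proof.
have D1 := is_deriveB (is_derive_cst (rho ^+ 2) x (delta_mx ord0 j)) (is_derive_sqnorm a x j).
have D2 := is_derive_comp_real D1 (is_derive_flat_exp 0 _).
apply: (is_derive_eq D2).
by rewrite /= oppr0 mul0r add0r mul1r sub0r mulNr.
Qed.

Lemma smooth_pole_profile eta : 0 < eta -> smooth (pole_profile eta).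
Proof.
move=> eta0; apply: (@smoothM _ _ (fun x => (sqnorm (x - a) + eta) `^ (- (k / 2)))).
  exact: smooth_powR_sqnorm.
exact: smooth_cutoff.
Qed.

Lemma pole_profile_out eta x : rho ^+ 2 <= sqnorm (x - a) -> pole_profile eta x = 0.
Proof. by move=> h; rewrite /pole_profile flat_exp0 ?mulr0// subr_le0. Qed.

Lemma sqnorm_coord (y : 'rV[R]_N) j r : 0 <= r -> sqnorm y <= r ^+ 2 -> `|y ord0 j| <= r.
Proof.
move=> r0 yr; rewrite -(@ler_pXn2r _ 2) ?nnegrE// real_normK ?num_real//.
apply: le_trans yr; rewrite /sqnorm (bigD1 j)//= lerDl.
by apply: sumr_ge0 => i _; exact: sqr_ge0.
Qed.

Lemma test_pole_profile (Omega : set 'rV[R]_N) (r eta : R) :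
  rho < r -> ball a r `<=` Omega -> 0 < eta ->
  test_function Omega (pole_profile eta).
Proof.
move=> rr aO eta0.
pose K := [set x : 'rV[R]_N | sqnorm (x - a) <= rho ^+ 2].
have cK : closed K.
  rewrite (_ : K = (fun x => sqnorm (x - a)) @^-1` [set t | t <= rho ^+ 2])//.
  apply: preimage_closed; last exact: closed_le.
  by move=> x _; apply: smooth_continuous; exact: smooth_sqnorm.
have sK : tsupport (pole_profile eta) `<=` K.
  rewrite [X in _ `<=` X](closure_id K).1//; apply: closureS => x /=.
  by apply: contraR; rewrite -ltNge => /ltW h; rewrite pole_profile_out.
have KO : K `<=` Omega.
  move=> x Kx; apply: aO; split; first exact: lt_trans rr.
  move=> i j; rewrite ord1 /ball /= distrC.
  by have := sqnorm_coord j (ltW rho0) Kx; rewrite !mxE; move/le_lt_trans; exact.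
split; [exact: smooth_pole_profile| |exact: subset_trans KO].
apply: (@subclosed_compact _ _ K) => //; first exact: closed_closure.
apply: bounded_closed_compact => //.
exists (`|a| + rho); split; first by rewrite realE addr_ge0// ltW.
move=> M aM x Kx.
rewrite /= [leLHS]mx_normrE; apply/bigmax_leP; split=> /=.
  by apply: ltW; apply: le_lt_trans aM; rewrite addr_ge0// ltW.
move=> [i j] _; rewrite ord1 /=; apply: le_trans (ltW aM).
have -> : x ord0 j = a ord0 j + (x - a) ord0 j by rewrite !mxE; ring.
apply: le_trans (ler_normD _ _) _; apply: lerD; last exact: sqnorm_coord (ltW rho0) Kx.
have : `|a| <= `|a| by [].
by rewrite {1}[`|a|]mx_normrE => /bigmax_leP[_ /(_ (ord0, j) isT)].
Qed.

Lemma sqnorm_grad_pole_profile eta x : 0 < eta ->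
  let q := sqnorm (x - a) in
  sqnorm (grad (pole_profile eta) x) =
  4 * q * ((q + eta) `^ (- (k / 2))) ^+ 2 *
   (k / 2 * flat_exp 0 (rho ^+ 2 - q) / (q + eta) + flat_exp 2 (rho ^+ 2 - q)) ^+ 2.
Proof.
move=> eta0 q; have qe : 0 < q + eta by rewrite ltr_wpDl ?sqnorm_ge0.
rewrite sqnorm_grad.
rewrite (_ : 4 * q * _ = 4 * ((q + eta) `^ (- (k / 2))) ^+ 2 * q); last by ring.
rewrite [X in _ * X * _]sqnormE mulr_sumr mulr_suml.
apply: eq_bigr => j _.
rewrite (partial_val (is_deriveM (is_derive_powR_sqnorm a (- (k / 2)) x j eta0)
  (is_derive_cutoff x j))).
rewrite /GRing.scale /= -/q powRB; last by rewrite (gt_eqF qe) implybT.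
by rewrite powRr1 ?(ltW qe)//; field; rewrite gt_eqF.
Qed.

(** The gradient is radial, with a main term from the power and a term from
    the cutoff, separated by Young's inequality. The main term gives [k^2]. The
    cutoff term carries an additional factor [q^2] relative to [f^2 / q]: it is
    absorbed by [eps] near the pole, where the cutoff is bounded below, and
    away from the pole it is bounded independently of [eta]. *)
Lemma grad_pole_profile_le eps : 0 < eps ->
  exists2 K, 0 <= K & forall eta x, 0 < eta ->
   sqnorm (grad (pole_profile eta) x) <=
   (k ^+ 2 + eps) * (pole_profile eta x ^+ 2 / sqnorm (x - a)) + K.
Proof.
move=> eps0.
pose t := eps / (2 * k ^+ 2).
have k20 : 0 < k ^+ 2 by rewrite exprn_gt0.
have t0 : 0 < t by rewrite divr_gt0// mulr_gt0.
pose L := 16 * (1 + t^-1).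
have L0 : 0 < L by rewrite mulr_gt0// addr_gt0// invr_gt0.
pose h := rho ^+ 2 / 2.
have h0 : 0 < h by rewrite divr_gt0// exprn_gt0.
pose c := expR (- h^-1).
have c0 : 0 < c by exact: expR_gt0.
(* d is the radius, squared, separating the two regimes of the cutoff term *)
pose d := Num.min h (Num.min 1 (eps * c ^+ 2 / (2 * L))).
have d0 : 0 < d by rewrite !lt_min h0 ltr01 divr_gt0// mulr_gt0// exprn_gt0.
have dh : d <= h by rewrite ge_min lexx.
have d1 : d <= 1 by rewrite !ge_min lexx orbT.
have dL : L * d ^+ 2 <= eps / 2 * c ^+ 2.
  have : d <= eps * c ^+ 2 / (2 * L) by rewrite !ge_min lexx !orbT.
  have L2 : 0 < 2 * L by apply: mulr_gt0.
  rewrite ler_pdivlMr// => H.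
  have : d ^+ 2 <= d by rewrite expr2 ler_piMl// ltW.
  by move=> /(ler_wpM2l (ltW L0)); lra.
pose K := L * rho ^+ 2 * (d `^ (- (k / 2))) ^+ 2.
have K0 : 0 <= K by rewrite mulr_ge0 ?sqr_ge0// mulr_ge0 ?sqr_ge0// ltW.
exists K => // eta x eta0; rewrite sqnorm_grad_pole_profile// /pole_profile.
set q := sqnorm (x - a); have q_ge0 : 0 <= q by exact: sqnorm_ge0.
set b := flat_exp 0 _; set b' := flat_exp 2 _.
have b0 : 0 <= b by exact: flat_exp_ge0.
have b'0 : 0 <= b' by exact: flat_exp_ge0.
have b'2 : b' ^+ 2 <= 4.
  have : b' <= 2 by exact: flat_exp2_le.
  by move=> ?; nra.
set w := _ `^ _; have w0 : 0 <= w by exact: powR_ge0.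
have [q0|qn0] := eqVneq q 0.
  by rewrite q0 mulr0 !mul0r invr0 !mulr0 add0r.
have q0 : 0 < q by rewrite lt_neqAle eq_sym qn0.
have A0 : 0 < q + eta by rewrite addr_gt0.
have w2 : 0 <= w ^+ 2 by exact: sqr_ge0.
(* t is chosen so that (1 + t) k^2 = k^2 + eps / 2 *)
have young : (k / 2 * b / (q + eta) + b') ^+ 2 <=
   (1 + t) * (k ^+ 2 / 4 * b ^+ 2 * (q + eta)^-1 ^+ 2) + (1 + t^-1) * b' ^+ 2.
  rewrite -subr_ge0 (_ : _ - _ = t^-1 * (t * (k / 2 * b / (q + eta)) - b') ^+ 2).
    by rewrite mulr_ge0 ?sqr_ge0// invr_ge0 ltW.
  by field; rewrite ?gt_eqF.
apply: le_trans (ler_wpM2l _ young) _.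
  by rewrite !mulr_ge0.
have qA : q * (q + eta)^-1 ^+ 2 <= q^-1.
  rewrite -[leRHS]mul1r ler_pdivlMr// mulrAC -expr2 -exprMn.
  rewrite expr_le1 ?mulr_ge0 ?invr_ge0 ?(ltW A0)//.
  by rewrite ler_pdivrMr// mul1r lerDl ltW.
have main : 4 * q * w ^+ 2 * ((1 + t) * (k ^+ 2 / 4 * b ^+ 2 * (q + eta)^-1 ^+ 2)) <=
   (k ^+ 2 + eps / 2) * ((w * b) ^+ 2 / q).
  rewrite (_ : k ^+ 2 + eps / 2 = (1 + t) * k ^+ 2); last first.
    by rewrite /t; field; rewrite gt_eqF.
  rewrite (_ : 4 * q * _ * _ = (1 + t) * k ^+ 2 * ((w * b) ^+ 2 * (q * (q + eta)^-1 ^+ 2))); last first.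
    by field; rewrite gt_eqF.
  apply: ler_wpM2l; first by rewrite mulr_ge0 ?sqr_ge0// addr_ge0// ltW.
  by apply: ler_wpM2l; [exact: sqr_ge0|exact: qA].
have rest : 4 * q * w ^+ 2 * ((1 + t^-1) * b' ^+ 2) <= eps / 2 * ((w * b) ^+ 2 / q) + K.
  have E : 4 * q * w ^+ 2 * ((1 + t^-1) * b' ^+ 2) <= L * q * w ^+ 2.
    rewrite (_ : L * q * w ^+ 2 = 4 * q * w ^+ 2 * ((1 + t^-1) * 4)); last by rewrite /L; ring.
    rewrite ler_wpM2l ?mulr_ge0// ler_wpM2l// addr_ge0// invr_ge0 ltW//.
  have P0 : 0 <= eps / 2 * ((w * b) ^+ 2 / q).
    by rewrite mulr_ge0 ?divr_ge0 ?sqr_ge0 ?(ltW eps0).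
  have [qd|dq] := leP q d.
    apply: le_trans E _; rewrite -[leLHS]addr0 lerD//.
    have cb : c <= b.
      apply: flat_exp_lower => //; have := le_trans qd dh; rewrite /h; lra.
    rewrite (_ : L * q * w ^+ 2 = w ^+ 2 * q^-1 * (L * q ^+ 2)); last by field; rewrite gt_eqF.
    rewrite (_ : eps / 2 * _ = w ^+ 2 * q^-1 * (eps / 2 * b ^+ 2)); last by field; rewrite gt_eqF.
    apply: ler_wpM2l; first by rewrite mulr_ge0 ?invr_ge0.
    apply: (@le_trans _ _ (L * d ^+ 2)).
      by apply: ler_wpM2l; [exact: ltW|rewrite lerXn2r ?nnegrE// ltW].
    apply: le_trans dL _; apply: ler_wpM2l; first by rewrite divr_ge0 ?(ltW eps0).
    by rewrite lerXn2r ?nnegrE// ltW.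
  have [rq|qr] := leP (rho ^+ 2) q.
    have -> : b' = 0 by apply: flat_exp0; rewrite subr_le0.
    by rewrite expr0n /= !mulr0 addr_ge0.
  apply: le_trans E _; rewrite -[leLHS]add0r lerD//.
  apply: ler_pM => //; first by apply: mulr_ge0 => //; exact: ltW.
    by apply: ler_wpM2l; exact: ltW.
  rewrite lerXn2r ?nnegrE ?powR_ge0// /w !powRN lef_pV2 ?posrE ?powR_gt0//.
  rewrite ge0_ler_powR ?nnegrE ?divr_ge0 ?(ltW k0) ?(ltW d0) ?(ltW A0)//.
  by apply: ltW; apply: lt_le_trans dq _; rewrite lerDl ltW.
by rewrite mulrDr; apply: le_trans (lerD main rest) _; rewrite addrA -mulrDl; lra.
Qed.

End pole_profile.

(** * Logarithmic divergence at a pole *)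

(** Boxes in the corner of the dyadic shells around [a]: they are disjoint for
    geometrically decreasing [s], and their measure is explicit. *)
Definition corner_box (R : realType) (N : nat) (a : 'rV[R]_N) (s : R) :=
  [set x : 'rV[R]_N | forall j, `]a ord0 j + s / 2, a ord0 j + s[%classic (x ord0 j)].

Section corner_box.
Variables (R : realType) (N : nat) (a : 'rV[R]_N).
Implicit Type s : R.

Lemma corner_boxP s x : corner_box a s x -> forall j, s / 2 < x ord0 j - a ord0 j < s.
Proof.
by move=> h j; have := h j; rewrite /= in_itv /= => /andP[? ?]; apply/andP; split; lra.
Qed.

Lemma measurable_corner_box s : measurable (corner_box a s).
Proof.
have -> : corner_box a s = \bigcap_(i in [set: 'I_N])
    ((fun x : 'rV[R]_N => x ord0 i) @^-1` `]a ord0 i + s / 2, a ord0 i + s[).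
  by apply/seteqP; split => [x h i _|x h i]; exact: h.
apply: fin_bigcap_measurable => [|i _]; first exact: finite_finset.
by rewrite -[X in measurable X]setTI; exact: measurable_coord.
Qed.

Lemma leb_corner_box s : 0 < s -> leb (corner_box a s) = ((s / 2) ^+ N)%:E.
Proof.
move=> s0; rewrite /corner_box
  (leb_box (A := fun j => `]a ord0 j + s / 2, a ord0 j + s[%classic))//.
rewrite (eq_bigr (fun=> (s / 2)%:E)) => [|i _].
  by rewrite prodEFin prodr_const card_ord.
rewrite lebesgue_measure_itv /= lte_fin ifT; last by lra.
by rewrite -EFinB; congr EFin; lra.
Qed.

Lemma corner_box_disjoint s t : (0 < N)%N -> s <= t / 2 ->
  corner_box a s `&` corner_box a t = set0.
Proof.
move=> N0 st; apply/seteqP; split => // x [] /corner_boxP/(_ (Ordinal N0))/andP[_ h1].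
by move=> /corner_boxP/(_ (Ordinal N0))/andP[h2 _]; lra.
Qed.

Lemma sqnorm_corner_box s x : (0 < N)%N -> 0 < s -> corner_box a s x ->
  0 < sqnorm (x - a) <= N%:R * s ^+ 2.
Proof.
move=> N0 s0 /corner_boxP bx; apply/andP; split.
  rewrite sqnormE (bigD1 (Ordinal N0))//= ltr_wpDr//.
    by apply: sumr_ge0 => i _; exact: sqr_ge0.
  by rewrite exprn_gt0//; have /andP[h _] := bx (Ordinal N0); lra.
rewrite sqnormE mulr_natl -[X in _ *+ X](card_ord N) -sumr_const.
apply: ler_sum => j _; have /andP[? ?] := bx j.
by rewrite lerXn2r ?nnegrE; lra.
Qed.
End corner_box.

(** On the box of size [s], with [s^2 >= eta], the integrand is of order
    [s^-N], so each dyadic box with [eta <= s^2] contributes at least the same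
    amount [kap], and the smaller [eta], the more such boxes there are. *)
Lemma pole_profile_integral_unbounded (R : realType) (N : nat) (a : 'rV[R]_N)
    (Omega : set 'rV[R]_N) (rho r B : R) :
  (3 <= N)%N -> open Omega -> 0 < rho -> rho < r -> ball a r `<=` Omega ->
  exists2 eta, 0 < eta &
   (B%:E <= \int[leb]_(x in Omega)
     (pole_profile a ((N%:R - 2) / 2) rho eta x ^+ 2 / sqnorm (x - a))%:E)%E.
Proof.
move=> N3 oO rho0 rr aO.
have N0 : (0 < N)%N by apply: leq_trans N3.
have NR : 0 < N%:R :> R by rewrite ltr0n.
have mO : measurable Omega by exact: open_measurable_rV.
pose k : R := (N%:R - 2) / 2; rewrite -/k.
pose h := rho ^+ 2 / 2.
have h0 : 0 < h by rewrite divr_gt0// exprn_gt0.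
pose c := expR (- h^-1).
have c0 : 0 < c by exact: expR_gt0.
pose r0 := Num.min rho (Num.min 1 (h / N%:R)).
have r00 : 0 < r0 by rewrite !lt_min rho0 ltr01 divr_gt0.
have r0rho : r0 <= rho by rewrite ge_min lexx.
have r01 : r0 <= 1 by rewrite !ge_min lexx orbT.
have r0h : N%:R * r0 ^+ 2 <= h.
  have : r0 <= h / N%:R by rewrite !ge_min lexx !orbT.
  rewrite ler_pdivlMr// mulrC; apply: le_trans.
  by rewrite ler_wpM2l// expr2 ler_piMl// ltW.
pose s (l : nat) : R := r0 / 2 ^+ l.
have s0 l : 0 < s l by rewrite divr_gt0// exprn_gt0.
have s_ni l m : (l <= m)%N -> s m <= s l.
  by move=> lm; rewrite ler_wpM2l ?(ltW r00)// lef_pV2 ?posrE ?exprn_gt0// ler_eXn2l// ltr1n.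
have s_half l m : (l < m)%N -> s m <= s l / 2.
  move=> /s_ni /le_trans; apply.
  by rewrite le_eqVlt /s exprS; apply/orP; left; apply/eqP; field; rewrite expf_neq0.
have sr0 l : s l <= r0 by apply: le_trans (s_ni 0%N l _) _ => //; rewrite /s expr0 divr1.
pose kap := c ^+ 2 * ((N%:R + 1) `^ (- (k / 2))) ^+ 2 / N%:R / 2 ^+ N.
have kap0 : 0 < kap.
  have N1 : 0 < (N%:R + 1) `^ (- (k / 2)) by rewrite powR_gt0// addr_gt0.
  by do 2![apply: divr_gt0 => //]; apply: mulr_gt0; exact: exprn_gt0.
pose J := Num.truncn (B / kap).
have JB : B <= J.+1%:R * kap.
  by rewrite -ler_pdivrMr//; apply: ltW; exact: truncnS_gt.
exists (s J ^+ 2); first by rewrite exprn_gt0.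
set eta := s J ^+ 2.
have eta0 : 0 < eta by rewrite exprn_gt0.
pose f := pole_profile a k rho eta.
have sf : smooth f by exact: smooth_pole_profile.
have mf : measurable_fun Omega (fun x => f x ^+ 2 / sqnorm (x - a)).
  apply: measurable_sqnorm_weight; apply: measurable_funTS.
  by apply: continuous_measurable_rV; exact: smooth_continuous.
have f0 x : 0 <= f x ^+ 2 / sqnorm (x - a).
  by rewrite divr_ge0 ?sqr_ge0// sqnorm_ge0.
have bO l : corner_box a (s l) `<=` Omega.
  move=> x /corner_boxP bx; apply: aO; split; first exact: lt_trans rr.
  move=> i j; rewrite ord1 /ball /= distrC; have /andP[h1 h2] := bx j.
  rewrite ger0_norm; last by have := s0 l; lra.
  by apply: lt_trans h2 _; apply: le_lt_trans (sr0 l) (le_lt_trans r0rho rr).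
have low l x : (l <= J)%N -> corner_box a (s l) x ->
    kap * (s l / 2) ^- N <= f x ^+ 2 / sqnorm (x - a).
  move=> lJ bx; have /andP[q0 qs] := sqnorm_corner_box N0 (s0 l) bx.
  rewrite /f /pole_profile; set q := sqnorm _ in q0 qs *.
  have s20 : 0 < s l ^+ 2 by rewrite exprn_gt0.
  have A0 : 0 < q + eta by rewrite addr_gt0.
  have As : q + eta <= (N%:R + 1) * s l ^+ 2.
    rewrite mulrDl mul1r lerD// /eta lerXn2r ?nnegrE ?(ltW (s0 _))//.
    exact: s_ni.
  have cb : c <= flat_exp 0 (rho ^+ 2 - q).
    apply: flat_exp_lower => //.
    have : q <= h.
      apply: le_trans qs _; apply: le_trans r0h; rewrite ler_wpM2l//.
      by rewrite lerXn2r ?nnegrE ?(ltW r00) ?(ltW (s0 _)).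
    by rewrite /h; lra.
  have k0 : 0 <= k / 2.
    by rewrite /k !divr_ge0// subr_ge0 ler_nat ltnW.
  have wA : ((N%:R + 1) `^ (- (k / 2))) ^+ 2 * ((s l ^+ 2) `^ (- (k / 2))) ^+ 2
      <= ((q + eta) `^ (- (k / 2))) ^+ 2.
    have N1 : 0 < N%:R + 1 :> R by rewrite addr_gt0.
    rewrite -exprMn -powRM ?(ltW N1) ?(ltW s20)//.
    rewrite lerXn2r ?nnegrE ?powR_ge0// !powRN lef_pV2 ?posrE ?powR_gt0 ?mulr_gt0//.
    by rewrite ge0_ler_powR ?nnegrE ?(ltW A0)// mulr_ge0 ?(ltW N1) ?(ltW s20).
  have sN : ((s l ^+ 2) `^ (- (k / 2))) ^+ 2 = s l ^+ 2 / s l ^+ N.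
    rewrite -powR_mulrn ?powR_ge0// -powRrM -powR_mulrn ?(ltW (s0 _))// -powRrM.
    rewrite -powR_mulrn ?(ltW (s0 _))// -powRB ?(gt_eqF (s0 _)) ?implybT//.
    by congr (_ `^ _); rewrite /k; field.
  rewrite [(_ * _) ^+ 2]exprMn.
  apply: (@le_trans _ _ (((N%:R + 1) `^ (- (k / 2))) ^+ 2 * (s l ^+ 2 / s l ^+ N) * c ^+ 2 / (N%:R * s l ^+ 2))).
    rewrite /kap le_eqVlt; apply/orP; left; apply/eqP.
    have X0 : s l ^+ N != 0 by rewrite expf_neq0// gt_eqF.
    have Y0 : 2 ^+ N != 0 :> R by rewrite expf_neq0.
    have NR0 : N%:R != 0 :> R by rewrite gt_eqF.
    have S0 : s l != 0 by rewrite gt_eqF.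
    have alg (S M Y X w d : R) : X != 0 -> Y != 0 -> M != 0 -> S != 0 ->
        d ^+ 2 * w ^+ 2 / M / Y * (X / Y)^-1 = w ^+ 2 * (S ^+ 2 / X) * d ^+ 2 / (M * S ^+ 2).
      by move=> X1 Y1 M1 S1; field; rewrite X1 Y1 M1 S1.
    by rewrite expr_div_n; exact: alg.
  rewrite -sN; apply: ler_pM.
  - by apply: mulr_ge0; [apply: mulr_ge0|]; exact: sqr_ge0.
  - by rewrite invr_ge0; apply: mulr_ge0 => //; exact: ltW.
  - apply: ler_pM; [by apply: mulr_ge0; exact: sqr_ge0|exact: sqr_ge0|exact: wA|].
    by rewrite lerXn2r ?nnegrE ?flat_exp_ge0 ?(ltW c0).
  - by rewrite lef_pV2 ?posrE//; apply: mulr_gt0.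
pose U := \big[setU/set0]_(l <- iota 0 J.+1) corner_box a (s l).
have mU : measurable U by apply: bigsetU_measurable => l _; exact: measurable_corner_box.
have UO : U `<=` Omega.
  by move=> x; rewrite /U -bigcup_seq => -[l _]; exact: bO.
apply: (@le_trans _ _ (\int[leb]_(x in U) (f x ^+ 2 / sqnorm (x - a))%:E)%E); last first.
  apply: ge0_subset_integral => //.
  - exact/measurable_EFinP.
  - by move=> x _; rewrite lee_fin.
rewrite ge0_integral_bigsetU//; last 5 first.
- by move=> l; exact: measurable_corner_box.
- exact: iota_uniq.
- move=> l m _ _ [x [lx mx]]; case: (ltngtP l m) => // lm.
    have := corner_box_disjoint a N0 (s_half _ _ lm).
    by move=> /seteqP[/(_ x (conj mx lx))].
  have := corner_box_disjoint a N0 (s_half _ _ lm).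
  by move=> /seteqP[/(_ x (conj lx mx))].
- by apply/measurable_EFinP; exact: measurable_funS mf.
- by move=> x _; rewrite lee_fin.
apply: (@le_trans _ _ (\sum_(l <- iota 0 J.+1) kap%:E)%E).
  by rewrite sumEFin lee_fin big_const_seq count_predT size_iota iter_addr_0 -[kap *+ _]mulr_natl.
rewrite big_seq [X in (_ <= X)%E]big_seq; apply: lee_sum => l.
rewrite mem_iota add0n ltnS => /andP[_ lJ].
apply: (@le_trans _ _ (\int[leb]_(x in corner_box a (s l)) (cst (kap * (s l / 2) ^- N)%:E x))%E).
  rewrite integral_cst; last exact: measurable_corner_box.
  rewrite [X in (_ * X)%E](leb_corner_box a (s0 l)).
  by rewrite -EFinM lee_fin divfK// expf_neq0// gt_eqF// divr_gt0.
apply: ge0_le_integral => //.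
- exact: measurable_corner_box.
- move=> x _; rewrite lee_fin divr_ge0 ?(ltW kap0)// exprn_ge0// divr_ge0// ltW//.
- apply/measurable_EFinP; apply: measurable_funS mf => //.
- by move=> x bx; rewrite lee_fin low.
Qed.

(** * The sharp constant *)

Lemma bounded_leb_lty (R : realType) (n : nat) (Omega : set 'rV[R]_n) :
  measurable Omega -> bounded_set Omega -> (leb Omega < +oo)%E.
Proof.
move=> mO /bounded_coord[M OM].
have /integrableP[_] : leb.-integrable Omega (EFin \o cst (1 : R)).
  apply: (@measurable_bounded_support_integrable _ _ _ 1 M) => //.
    by move=> x _; rewrite normr1.
  by move=> x Ox _; exact: OM.
rewrite (_ : (fun x => _) = cst 1%E); first by rewrite integral_cst// mul1e.
by apply/funext => x /=; rewrite normr1.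
Qed.

(** If [C gamma_i > k^2], the inequality for the functions concentrating at
    [a_i] bounds [\int f^2 / q_i] uniformly in [eta], contradicting its
    divergence. Finiteness of this integral also comes from the inequality. *)
Lemma hardy_inequality_pole_le (R : realType) (N n : nat) (Omega : set 'rV[R]_N)
    (a : 'I_n -> 'rV[R]_N) (gamma : 'I_n -> R) (C : R) (i : 'I_n) :
  (3 <= N)%N -> open Omega -> bounded_set Omega -> Omega (a i) ->
  (forall j, 0 < gamma j) -> hardy_inequality Omega a gamma C ->
  C * gamma i <= (N%:R - 2) ^+ 2 / 4.
Proof.
move=> N3 oO bO aO g0 hC; rewrite leNgt; apply/negP => lt.
have mO : measurable Omega by exact: open_measurable_rV.
pose k : R := (N%:R - 2) / 2.
have k0 : 0 < k by rewrite divr_gt0// subr_gt0 ltr_nat.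
have k2E : (N%:R - 2) ^+ 2 / 4 = k ^+ 2 by rewrite /k; field.
rewrite k2E in lt.
have Cg0 : 0 < C * gamma i by apply: lt_trans lt; rewrite exprn_gt0.
have C0 : 0 < C by move: Cg0; rewrite pmulr_lgt0.
have [r /= r0 aO'] : nbhs_ball (a i) Omega.
  by apply/nbhs_ballP; exact: open_nbhs_nbhs.
pose rho := r / 2.
have rho0 : 0 < rho by rewrite divr_gt0.
have rr : rho < r by rewrite /rho; lra.
pose eps := (C * gamma i - k ^+ 2) / 2.
have eps0 : 0 < eps by rewrite divr_gt0// subr_gt0.
have [K K0 HK] := grad_pole_profile_le (a i) k0 rho0 eps0.
have lO : leb Omega \is a fin_num by rewrite ge0_fin_numE// bounded_leb_lty.
have [eta eta0 HB] := @pole_profile_integral_unbounded R N (a i) Omega rho r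
  (K * fine (leb Omega) / eps + 1) N3 oO rho0 rr aO'.
rewrite -/k in HB.
pose f := pole_profile (a i) k rho eta.
have tf : test_function Omega f by exact: (@test_pole_profile _ _ _ _ _ rho0 _ r).
have [sf cf _] := tf.
have mf : measurable_fun Omega f.
  by apply: measurable_funTS; apply: continuous_measurable_rV; exact: smooth_continuous.
have mfi j : measurable_fun Omega (fun x => (f x ^+ 2 / sqnorm (x - a j))).
  exact: measurable_sqnorm_weight.
pose I := (\int[leb]_(x in Omega) (f x ^+ 2 / sqnorm (x - a i))%:E)%E.
pose G := (\int[leb]_(x in Omega) (sqnorm (grad f x))%:E)%E.
have q0 x j : 0 <= f x ^+ 2 / sqnorm (x - a j) by rewrite divr_ge0 ?sqr_ge0// sqnorm_ge0.
have hardy : ((C * gamma i)%:E * I <= G)%E.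
  apply: le_trans (hC _ _ (test_H10 oO tf)).
  rewrite EFinM -muleA lee_wpmul2l ?lee_fin ?(ltW C0)//.
  rewrite (bigD1 i)//= -[leLHS]adde0; apply: leeD.
    rewrite -ge0_integralZl//; last 3 first.
    - exact/measurable_EFinP.
    - by move=> x _; rewrite lee_fin.
    - by rewrite lee_fin ltW.
    rewrite le_eqVlt; apply/orP; left; apply/eqP; apply: eq_integral => x _.
    by rewrite real_normK ?num_real// -EFinM.
  apply: sume_ge0 => j _; apply: integral_ge0 => x _; rewrite lee_fin.
  by rewrite mulr_ge0 ?(ltW (g0 j))// real_normK ?num_real.
have upper : (G <= (k ^+ 2 + eps)%:E * I + K%:E * leb Omega)%E.
  have -> : leb Omega = (\int[leb]_(x in Omega) (cst 1 x)%:E)%E.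
    transitivity (\int[leb]_(x in Omega) cst 1%:E x)%E => //.
    by rewrite integral_cst// mul1e.
  apply: ge0_integral_le_lincomb => //.
  - apply: measurable_funTS; apply: continuous_measurable_rV.
    under [X in continuous X]funext do rewrite sqnorm_grad.
    apply: continuous_sum_fun => j x.
    by apply: continuousM; apply: smooth_continuous; exact: smooth_partial.
  - by move=> x _; exact: sqnorm_ge0.
  - by rewrite addr_ge0 ?sqr_ge0// ltW.
  - by move=> x _; rewrite mulr1; exact: HK.
have Gfin : (G < +oo)%E.
  have [_ hg _] := (test_H10 oO tf).1.
  rewrite /G; under eq_integral do rewrite /sqnorm -sumEFin.
  rewrite ge0_integral_sum//.
  - by apply: lte_sum_pinfty => j _; have [] := hg j.
  - by move=> j; apply/measurable_EFinP; apply: measurable_funX; have [] := hg j.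
  - by move=> j x _; rewrite lee_fin sqr_ge0.
have I0 : (0 <= I)%E by apply: integral_ge0 => x _; rewrite lee_fin.
have : I \is a fin_num.
  rewrite ge0_fin_numE// ltNge leye_eq; apply/negP => /eqP Ioo.
  have := le_lt_trans hardy Gfin; by rewrite Ioo gt0_muley ?lte_fin.
move: lO HB hardy upper; rewrite -/f -/I.
case: (leb Omega) => [l| |]// _; case: I I0 => [t| |]// t0.
rewrite lee_fin => HB hardy upper _; have := le_trans hardy upper.
rewrite -!EFinM -EFinD lee_fin /= => H.
have epsE : C * gamma i = k ^+ 2 + 2 * eps by rewrite /eps; field.
have : eps * t <= K * l by move: H; rewrite epsE; clear; move: eps (k ^+ 2) => e k2; lra.
have : K * l < eps * t.
  apply: (@lt_le_trans _ _ (eps * (K * l / eps + 1))); last by rewrite ler_wpM2l// ltW.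
  by rewrite mulrDr mulrCA divff ?gt_eqF// !mulr1 ltrDl.
by rewrite ltNge => /negbTE ->.
Qed.

Theorem theorem4p3 (R : realType) (N n : nat) (Omega : set 'rV[R]_N)
    (a : 'I_n -> 'rV[R]_N) (gamma : 'I_n -> R) (C : R)
    (hN : (3 <= N)%N) (hn : (2 <= n)%N)
    (Omega_open : open Omega) (Omega_connected : connected Omega)
    (Omega_bounded : bounded_set Omega)
    (a_inj : injective a) (a_Omega : forall i, Omega (a i))
    (gamma_gt0 : forall i, 0 < gamma i)
    (C_sharp : sharp_hardy_constant Omega a gamma C) :
  (N%:R - 2) ^+ 2 / 4 < C * \sum_(i < n) gamma i /\
  (\big[maxe/-oo]_(i < n) (C * gamma i)%:E <= ((N%:R - 2) ^+ 2 / 4)%:E)%E.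
Proof.
have [hardyC C_max] := C_sharp; split.
  have [C' hardyC' ltC'] := multipole_hardy_improved hN hn Omega_open Omega_bounded
    a_inj a_Omega gamma_gt0.
  apply: lt_le_trans ltC' _; apply: ler_wpM2r; last exact: C_max.
  by apply: sumr_ge0 => i _; exact: ltW.
apply: (big_ind (fun x => (x <= ((N%:R - 2) ^+ 2 / 4)%:E)%E)) => [|x y hx hy|i _].
- exact: leNye.
- by rewrite ge_max hx hy.
- by rewrite lee_fin; exact: hardy_inequality_pole_le hardyC.
Qed.
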